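(* Let $R=k[x_1,\ldots,x_n]$ be a polynomial ring in $n$ variables over a field $k$ with maximal ideal $\mathfrak m:=(x_1,\ldots,x_n)$, and let $\mathfrak a$ be a squarefree monomial ideal of $R$. Let $t$ be a non-negative integer. If $\operatorname{cd}(\mathfrak a,R)\le n-t$, then $\operatorname{depth} R/\mathfrak a\ge t$.
   Context: $H^i_{\mathfrak a}(-)$ denotes the $i$th local cohomology functor with support in $\mathfrak a$, and $\operatorname{cd}(\mathfrak a,R)=\min\{i : H^j_{\mathfrak a}(R)=0 \text{ for all } j>i\}$. The depth of $R/\mathfrak a$ is taken with respect to $\mathfrak m$ (the length of a maximal $R/\mathfrak a$-regular sequence in $\mathfrak m$), with the depth of the zero module being $+\infty$. A squarefree monomial ideal is an ideal generated by squarefree monomials in $x_1,\ldots,x_n$. *)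

(* Defs.v *)
From HB Require Import structures.
From mathcomp Require Import all_boot all_order all_algebra.
From mathcomp Require Import generic_quotient ring_quotient.
From mathcomp Require Import mpoly.

Set Implicit Arguments.
Unset Strict Implicit.
Unset Printing Implicit Defensive.

Import GRing.Theory.
Local Open Scope ring_scope.
Local Open Scope quotient_scope.

(* An ideal of R is a submodule of the regular module R^o. Unlike the
   [idealr] of ring_quotient, this does not exclude the unit ideal. *)
Definition ideal (R : comNzRingType) := submodClosed R^o.

Section QuotientModule.
Variables (R : comNzRingType) (M : lmodType R) (N : submodClosed M).

(* [submodClosed] does not inherit from [zmodClosed], which the quotients of
   ring_quotient require. *)
Definition submod_pred : M -> bool := fun x => x \in N.

Lemma submod_pred_closed : zmod_closed submod_pred.
Proof. exact: GRing.submod_closedB (submodClosedP N). Qed.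

Definition submod_zmod : zmodClosed M :=
  HB.pack submod_pred (GRing.isZmodClosed.Build M submod_pred submod_pred_closed).

Definition quot_mod := Quotient.quot submod_zmod.

HB.instance Definition _ := GRing.Zmodule.on quot_mod.

Definition quot_pi (x : M) : quot_mod := \pi_(Quotient.quot submod_zmod) x.

Lemma quot_pi_eq (x y : M) : quot_pi x = quot_pi y <-> x - y \in N.
Proof.
have E : (x - y \in N) = (quot_pi x == quot_pi y).
  exact: (Quotient.idealrBE submod_zmod x y).
by rewrite E; split=> [->|/eqP].
Qed.

Lemma quot_piK (x : quot_mod) : quot_pi (repr x) = x.
Proof. exact: reprK. Qed.

Lemma quot_piD : {morph quot_pi : x y / x + y}.
Proof. by move=> x y; rewrite /quot_pi raddfD. Qed.

Definition quot_scale (a : R) (x : quot_mod) : quot_mod :=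
  quot_pi (a *: repr x).

Lemma quot_scale_pi (a : R) (x : M) :
  quot_scale a (quot_pi x) = quot_pi (a *: x).
Proof.
by apply/quot_pi_eq; rewrite -scalerBr rpredZ //; apply/quot_pi_eq/quot_piK.
Qed.

Lemma quot_scaleA (a b : R) (x : quot_mod) :
  quot_scale a (quot_scale b x) = quot_scale (a * b) x.
Proof. by rewrite -[x]quot_piK !quot_scale_pi scalerA. Qed.

Lemma quot_scale1 : left_id 1 quot_scale.
Proof. by move=> x; rewrite -[x]quot_piK quot_scale_pi scale1r. Qed.

Lemma quot_scaleDr : right_distributive quot_scale +%R.
Proof.
move=> a x y; rewrite -[x]quot_piK -[y]quot_piK -quot_piD.
by rewrite !quot_scale_pi scalerDr quot_piD.
Qed.

Lemma quot_scaleDl (x : quot_mod) : {morph quot_scale^~ x : a b / a + b}.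
Proof.
by move=> a b; rewrite -[x]quot_piK !quot_scale_pi scalerDl quot_piD.
Qed.

HB.instance Definition _ := GRing.Zmodule_isLmodule.Build R quot_mod
  quot_scaleA quot_scale1 quot_scaleDr quot_scaleDl.
End QuotientModule.

Section LocalCohomology.
Variable R : comNzRingType.

Definition injective_module (E : lmodType R) : Prop :=
  forall (A B : lmodType R) (i : {linear A -> B}) (f : {linear A -> E}),
    injective i -> exists g : {linear B -> E}, forall x, g (i x) = f x.

Record injective_resolution (M : lmodType R) := InjectiveResolution {
  ires_mod : nat -> lmodType R;
  ires_aug : {linear M -> ires_mod 0%N};
  ires_d : forall i, {linear ires_mod i -> ires_mod i.+1};
  _ : forall i, injective_module (ires_mod i);
  _ : injective ires_aug;
  _ : forall x, ires_d 0%N x = 0 <-> exists m, x = ires_aug m;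
  _ : forall i x, ires_d i.+1 x = 0 <-> exists y, x = ires_d i y
}.

Fixpoint ideal_pow (a : ideal R) (N : nat) (r : R) : Prop :=
  if N is N'.+1 then
    exists s : seq (R * R),
      (forall p, p \in s -> p.1 \in a /\ ideal_pow a N' p.2)
      /\ r = \sum_(p <- s) p.1 * p.2
  else True.

(* The functor Gamma_a: membership in the submodule of a-power torsion. *)
Definition torsion (a : ideal R) (M : lmodType R) (x : M) : Prop :=
  exists N : nat, forall r : R, ideal_pow a N r -> r *: x = 0.

(* The i-th cohomology of the complex Gamma_a(E^0) -> Gamma_a(E^1) -> ... *)
Definition torsion_cohomology_eq0 (a : ideal R) (M : lmodType R)
    (E : injective_resolution M) (i : nat) : Prop :=
  match i with
  | 0 => forall x : ires_mod E 0, torsion a x -> ires_d E 0 x = 0 -> x = 0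
  | j.+1 => forall x : ires_mod E j.+1, torsion a x -> ires_d E j.+1 x = 0 ->
      exists y : ires_mod E j, torsion a y /\ x = ires_d E j y
  end.

(* H^i_a(M) = 0, where H^i_a is the i-th right derived functor of Gamma_a.
   Two injective resolutions of M are homotopy equivalent, so the choice of
   the resolution does not matter. *)
Definition local_cohomology_eq0 (a : ideal R) (M : lmodType R) (i : nat) :
    Prop :=
  exists E : injective_resolution M, torsion_cohomology_eq0 a E i.

(* c = cd(a, R). For the unit ideal, all of whose local cohomology vanishes,
   this is c = 0. *)
Definition is_cd (a : ideal R) (c : nat) : Prop :=
  let vanishes_above b :=
    forall j : nat, (b < j)%N -> local_cohomology_eq0 a R^o j in
  vanishes_above c /\ forall b : nat, vanishes_above b -> (c <= b)%N.
End LocalCohomology.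

Section Depth.
Variable R : comNzRingType.

Definition generated_by (s : seq R) (f : R) : Prop :=
  exists c : 'I_(size s) -> R, f = \sum_(i < size s) c i * s`_i.

(* x lies in the submodule (y_1, ..., y_r) M of M. *)
Definition in_smul (M : lmodType R) (y : seq R) (x : M) : Prop :=
  exists c : 'I_(size y) -> M, x = \sum_(i < size y) y`_i *: c i.

(* Each y_(i+1) is a nonzerodivisor on M / (y_1, ..., y_i) M, and
   M / (y_1, ..., y_r) M is nonzero. *)
Definition regular_seq (M : lmodType R) (y : seq R) : Prop :=
  (forall i, (i < size y)%N -> forall x : M,
      in_smul (take i y) (y`_i *: x) -> in_smul (take i y) x)
  /\ exists x : M, ~ in_smul y x.

Definition maximal_regular_seq (I : R -> Prop) (M : lmodType R) (y : seq R) :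
    Prop :=
  [/\ forall z, z \in y -> I z, regular_seq M y
    & forall z, I z -> ~ regular_seq M (rcons y z)].

(* [None] stands for +oo. *)
Definition is_depth (I : R -> Prop) (M : lmodType R) (d : option nat) : Prop :=
  match d with
  | Some r => exists2 y, maximal_regular_seq I M y & size y = r
  | None => forall x : M, x = 0
  end.
End Depth.

Definition ext_nat_ge (d : option nat) (t : nat) : Prop :=
  if d is Some r then (t <= r)%N else True.

Section Polynomials.
Variables (k : fieldType) (n : nat).

Definition irrelevant_ideal : {mpoly k[n]} -> Prop :=
  generated_by [seq 'X_i | i <- enum 'I_n].

Definition squarefree (m : 'X_{1..n}) : bool := [forall i, m i <= 1]%N.

Definition squarefree_monomial_ideal (a : ideal {mpoly k[n]}) : Prop :=
  exists2 s : seq 'X_{1..n}, all squarefree s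
    & forall f, f \in a <-> generated_by [seq 'X_[k, m] | m <- s] f.
End Polynomials.

Arguments irrelevant_ideal : clear implicits.

(* Main.v *)
(** Lyubeznik's argument.  Let T be the Taylor complex of the squarefree
    generators of the ideal a, and T_N that of their (N+1)st powers.  The comparison map
    Hom(T, R) -> Hom(T_N, R) is injective on cohomology: in each multidegree it
    is either an isomorphism or zero on a zero source, so it has a cochain
    retraction.  A chase in the double complex Hom(T, E), with E an injective
    resolution of R, turns the vanishing of H^j_a(R) into the exactness of
    Hom(T, R) in degree j.  Hence T splits above degree c = cd(a, R), and the
    Koszul homology H_i(x; R/a) vanishes for i > c.  If y is a regular sequence
    on R/a of length r, then H_i(x; R/(a, y)) vanishes for i > c + r; for
    i = n this is the socle, so for c + r < n no nonzero element of R/(a, y)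
    is killed by the irrelevant ideal.  As R is Noetherian, prime avoidance
    then gives a nonzerodivisor on R/(a, y) in the irrelevant ideal, and y is
    not maximal. *)

Require Import Defs.
From HB Require Import structures.
From mathcomp Require Import all_boot all_order all_algebra.
From mathcomp Require Import mpoly zify.
From Stdlib Require Import Classical ClassicalEpsilon.

Set Implicit Arguments.
Unset Strict Implicit.
Unset Printing Implicit Defensive.

Import Order.TTheory GRing.Theory.
Local Open Scope ring_scope.

(** * The Taylor complex of a family of monomials *)

(** The terms at (i, j) and (j, i) cancel in pairs; no division by 2 enters, so characteristic 2 is
    covered. *)
Lemma sum_antisym q (V : zmodType) (a : 'I_q -> 'I_q -> V) :
  (forall i j : 'I_q, (i < j)%N -> a j i = - a i j) ->
  \sum_i \sum_(j | j != i) a i j = 0.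
Proof.
move=> aN; under eq_bigr => i _ do rewrite (bigID (fun j : 'I_q => (j < i)%N)) /=.
rewrite big_split /= [X in _ + X](exchange_big_dep predT) //= -big_split /=.
apply: big1 => i _; rewrite -[RHS](addNr (\sum_(j < q | (j < i)%N) a j i)).
congr (_ + _); last first.
  apply: eq_bigl => j; rewrite -leqNgt -(inj_eq val_inj) /= eq_sym.
  by rewrite ltn_neqAle.
rewrite -sumrN; apply: eq_big => j; last by case/andP=> _ /aN.
by rewrite -(inj_eq val_inj) /= ltn_neqAle andbA andbb.
Qed.

Section Shift.
Variables (k : fieldType) (n : nat).
Implicit Types (m v : 'X_{1..n}) (f : {mpoly k[n]}).

Lemma mcoeffXM m f v :
  ('X_[m] * f)@_v = if (m <= v)%MM then f@_(v - m)%MM else 0.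
Proof.
rewrite mulrC; case: ifP => [/submK le_mv|nle].
  by rewrite -{1}le_mv addmC mcoeffMX.
apply/eqP; rewrite mcoeff_eq0; apply: contraFN nle => /msuppM_le/allpairsP.
by case=> -[u w] /= [_]; rewrite msuppX inE => /eqP-> ->; rewrite lem_addl.
Qed.

(** Division by ['X_[m]], dropping the terms that it does not divide: a left inverse of
    multiplication by ['X_[m]], linear over k but not over the polynomial ring. *)
Definition shift m f : {mpoly k[n]} :=
  \sum_(u <- msupp f | (m <= u)%MM) f@_u *: 'X_[u - m].

Lemma mcoeff_shift m f v : (shift m f)@_v = f@_(v + m)%MM.
Proof.
rewrite /shift raddf_sum /=.
have E u : (m <= u)%MM -> (f@_u *: 'X_[u - m])@_v = f@_u * (u == v + m)%MM%:R.
  move=> le_mu; rewrite mcoeffZ mcoeffX; congr (_ * _%:R).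
  by rewrite -(eqm_add2r m) submK.
rewrite (eq_bigr _ E) -big_filter.
have [in_f|out_f] := boolP (v + m \in msupp f)%MM.
  rewrite (bigD1_seq (v + m)%MM) ?mem_filter ?lem_addl ?filter_uniq //= eqxx mulr1.
  by rewrite big1 ?addr0 // => u /negPf->; rewrite mulr0.
rewrite big1_seq => [|u /andP[_]].
  by apply/esym/eqP; rewrite mcoeff_eq0.
by rewrite mem_filter; case: eqP => [->|_ _]; rewrite ?(negPf out_f) ?andbF ?mulr0.
Qed.

Lemma shiftD m : {morph shift m : f g / f + g}.
Proof. by move=> f g; apply/mpolyP => v; rewrite !(mcoeffD, mcoeff_shift). Qed.

Lemma shift0 m : shift m 0 = 0.
Proof. by apply/mpolyP => v; rewrite mcoeff_shift !mcoeff0. Qed.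

Lemma shift_sum m (I : Type) (r : seq I) P (F : I -> {mpoly k[n]}) :
  shift m (\sum_(i <- r | P i) F i) = \sum_(i <- r | P i) shift m (F i).
Proof. exact: (big_morph (shift m) (shiftD m) (shift0 m)). Qed.

Lemma shift_signM m (b : nat) f : shift m ((-1) ^+ b * f) = (-1) ^+ b * shift m f.
Proof.
apply/mpolyP => v; rewrite -signr_odd mcoeff_shift.
by case: odd; rewrite ?expr0 ?expr1 ?mul1r ?mulN1r ?mcoeffN mcoeff_shift.
Qed.

Lemma shiftXM m f : shift m ('X_[m] * f) = f.
Proof. by apply/mpolyP => v; rewrite mcoeff_shift mcoeffXM lem_addl addmK. Qed.

End Shift.

Section Complex.
Variables (k : fieldType) (n q : nat) (mon : 'I_q -> 'X_{1..n}).
Local Notation R := {mpoly k[n]}.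
Implicit Types (S : {set 'I_q}) (i j : 'I_q).

Definition lcmS S : 'X_{1..n} := [multinom \max_(i in S) mon i j | j < n].

Lemma lcmSE S l : lcmS S l = \max_(i in S) mon i l.
Proof. exact: mnmE. Qed.

Lemma lcmS0 : lcmS set0 = 0%MM.
Proof. by apply/mnmP => l; rewrite lcmSE big_set0 mnm0E. Qed.

Lemma lcmSU1 i S l : lcmS (i |: S) l = maxn (mon i l) (lcmS S l).
Proof.
rewrite !lcmSE; apply/eqP; rewrite eqn_leq; apply/andP; split.
  apply/bigmax_leqP => j; rewrite !inE leq_max => /orP[/eqP->|jS].
    by rewrite leqnn.
  by rewrite orbC (bigop.bigmax_sup j).
rewrite geq_max (bigop.bigmax_sup i) ?setU11 //=.
by apply/bigmax_leqP => j jS; rewrite (bigop.bigmax_sup j) ?setU1r.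
Qed.

Lemma lcmSU1_le i S : (lcmS S <= lcmS (i |: S))%MM.
Proof. by apply/mnm_lepP => l; rewrite lcmSU1 leq_maxr. Qed.

(** The Koszul sign. The index i itself is never counted, so inserting i into S and removing it
    again carry the same sign. *)
Definition subset_sign S i : R := (-1) ^+ #|[set j in S | (j < i)%N]|.

Definition lcm_ratio S S' : R := 'X_[lcmS S' - lcmS S].

Lemma subset_signU1 S i j : j \notin S ->
  subset_sign (j |: S) i = (-1) ^+ (j < i)%N * subset_sign S i.
Proof.
move=> jS; rewrite /subset_sign -exprD; congr (_ ^+ _).
case: ltnP => ji /=.
  rewrite (_ : [set _ in _ | _] = j |: [set j0 in S | (j0 < i)%N]).
    by rewrite cardsU1 !inE (negPf jS).
  by apply/setP => l; rewrite !inE; case: eqP => // ->; rewrite ji.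
rewrite add0n; apply: eq_card => l; rewrite !inE.
by case: eqP => //= ->; rewrite (negPf jS) ltnNge ji.
Qed.

Lemma subset_signD1 S i : subset_sign (S :\ i) i = subset_sign S i.
Proof.
congr (_ ^+ _); apply: eq_card => l; rewrite !inE.
by case: eqP => //= ->; rewrite ltnn andbF.
Qed.

Lemma subset_sign_sq S i : subset_sign S i * subset_sign S i = 1.
Proof. by rewrite /subset_sign -expr2 sqrr_sign. Qed.

Lemma subset_sign_antisym S i j : i != j -> i \notin S -> j \notin S ->
  subset_sign S j * subset_sign (j |: S) i = - (subset_sign S i * subset_sign (i |: S) j).
Proof.
move=> ij iS jS; rewrite !subset_signU1 // mulrCA [subset_sign S j * _]mulrC [subset_sign S i * _ in RHS]mulrCA.
rewrite -mulNr; congr (_ * _).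
case: ltngtP ij => [lt|lt|/val_inj->]; rewrite ?eqxx //= ?expr1 ?expr0 ?opprK //.
Qed.

Section Chains.
Variable V : lmodType R.
Implicit Types f g : {set 'I_q} -> V.

(* Chains and cochains are indexed by all subsets of the generators; the
   homological degree of f is recorded by [pure p f]. *)
Definition bdy f S : V :=
  \sum_(i | i \notin S) (subset_sign S i * lcm_ratio S (i |: S)) *: f (i |: S).

Definition cob g S : V :=
  \sum_(i in S) (subset_sign S i * lcm_ratio (S :\ i) S) *: g (S :\ i).

Definition pure p f := forall S, #|S| != p -> f S = 0.

Definition trunc p f S : V := if #|S| == p then f S else 0.

Lemma eq_bdy f g : f =1 g -> bdy f =1 bdy g.
Proof. by move=> fg S; apply: eq_bigr => i _; rewrite fg. Qed.

Lemma eq_cob f g : f =1 g -> cob f =1 cob g.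
Proof. by move=> fg S; apply: eq_bigr => i _; rewrite fg. Qed.

Lemma bdyB f g S : bdy (fun S => f S - g S) S = bdy f S - bdy g S.
Proof. by rewrite -sumrB; apply: eq_bigr => i _; rewrite scalerBr. Qed.

Lemma bdyD f g S : bdy (fun S => f S + g S) S = bdy f S + bdy g S.
Proof. by rewrite -big_split; apply: eq_bigr => i _; rewrite scalerDr. Qed.

Lemma bdyZ a f S : bdy (fun S => a *: f S) S = a *: bdy f S.
Proof. by rewrite scaler_sumr; apply: eq_bigr => i _; rewrite !scalerA mulrC. Qed.

Lemma bdy0 S : bdy (fun=> 0) S = 0.
Proof. by rewrite /bdy big1 // => i _; rewrite scaler0. Qed.

Lemma cobB f g S : cob (fun S => f S - g S) S = cob f S - cob g S.
Proof. by rewrite -sumrB; apply: eq_bigr => i _; rewrite scalerBr. Qed.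

Lemma trunc_pure p f : pure p (trunc p f).
Proof. by move=> S Sp; rewrite /trunc (negPf Sp). Qed.

Lemma pure_trunc p f : pure p f -> trunc p f =1 f.
Proof. by move=> pf S; rewrite /trunc; case: eqP => // /eqP/pf->. Qed.

Lemma bdy_trunc p f S : bdy (trunc p.+1 f) S = trunc p (bdy f) S.
Proof.
rewrite /trunc; case: ifP => Sp.
  by apply: eq_bigr => i iS; rewrite cardsU1 iS eqSS Sp.
by apply: big1 => i iS; rewrite cardsU1 iS eqSS Sp scaler0.
Qed.

Lemma cob_trunc p f S : cob (trunc p f) S = trunc p.+1 (cob f) S.
Proof.
rewrite /trunc; case: ifP => Sp.
  by apply: eq_bigr => i iS; move: Sp; rewrite (cardsD1 i) iS eqSS => ->.
by apply: big1 => i iS; move: Sp; rewrite (cardsD1 i) iS eqSS => ->; rewrite scaler0.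
Qed.

Lemma trunc0 p f S : f S = 0 -> trunc p f S = 0.
Proof. by rewrite /trunc => ->; rewrite if_same. Qed.

Lemma bdy_pure p f : pure p.+1 f -> pure p (bdy f).
Proof.
move=> pf S Sp; rewrite -(eq_bdy (pure_trunc pf)) bdy_trunc.
exact: trunc_pure.
Qed.

Lemma cob_pure p f : pure p f -> pure p.+1 (cob f).
Proof.
move=> pf S Sp; rewrite -(eq_cob (pure_trunc pf)) cob_trunc.
exact: trunc_pure.
Qed.

Lemma bdy_bdy f S : bdy (bdy f) S = 0.
Proof.
(* Terms with an index in S are set to zero, so that the double sum runs over all pairs of distinct
   indices, as in [sum_antisym]. *)
pose a i j : V := if (i \notin S) && (j \notin S) then
  (subset_sign S i * subset_sign (i |: S) j * 'X_[lcmS (j |: (i |: S)) - lcmS S]) *: f (j |: (i |: S))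
  else 0.
have <- : \sum_i \sum_(j | j != i) a i j = 0.
  apply: sum_antisym => i j lt_ij; rewrite /a andbC; case: ifP => [/andP[iS jS]|].
    rewrite subset_sign_antisym // -?(inj_eq val_inj) /= ?neq_ltn ?lt_ij //.
    by rewrite !mulNr scaleNr setUCA.
  by rewrite oppr0.
rewrite /bdy big_mkcond /=; apply: eq_bigr => i _; case: ifP => iS.
  rewrite scaler_sumr [RHS]big_mkcond [LHS]big_mkcond /=; apply: eq_bigr => j _.
  rewrite !inE negb_or; case: eqP => //= _; rewrite /a iS /=; case: ifP => // jS.
  rewrite scalerA; congr (_ *: _).
  rewrite mulrACA; congr (_ * _); rewrite /lcm_ratio -mpolyXD; congr 'X_[_].
  apply/mnmP => l; rewrite mnmDE !mnmBE.
  have /mnm_lepP/(_ l) := lcmSU1_le i S.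
  have /mnm_lepP/(_ l) := lcmSU1_le j (i |: S).
  by move=> ? ?; rewrite addnC addnBA // subnK.
by rewrite big1 // => j _; rewrite /a iS.
Qed.

End Chains.

(** Linearity is asked of a bare function, so that unpacked maps such as evaluation at a subset can
    be used. *)
Lemma bdy_linear (V W : lmodType R) (L : V -> W) (f : {set 'I_q} -> V) S :
  (forall a x y, L (a *: x + y) = a *: L x + L y) ->
  bdy (fun S => L (f S)) S = L (bdy f S).
Proof.
move=> Ll; have L0 : L 0 = 0.
  by have := Ll (-1) 0 0; rewrite scaler0 addr0 scaleN1r addNr.
rewrite /bdy; apply: esym; apply: (big_ind2 (fun x y => L x = y)) => //.
  by move=> x1 x2 y1 y2 <- <-; have := Ll 1 x1 y1; rewrite !scale1r.
by move=> i _; have := Ll (subset_sign S i * lcm_ratio S (i |: S)) (f (i |: S)) 0; rewrite !addr0 L0 addr0.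
Qed.

Lemma cob_linear (V W : lmodType R) (L : V -> W) (f : {set 'I_q} -> V) S :
  (forall a x y, L (a *: x + y) = a *: L x + L y) ->
  cob (fun S => L (f S)) S = L (cob f S).
Proof.
move=> Ll; have L0 : L 0 = 0.
  by have := Ll (-1) 0 0; rewrite scaler0 addr0 scaleN1r addNr.
rewrite /cob; apply: esym; apply: (big_ind2 (fun x y => L x = y)) => //.
  by move=> x1 x2 y1 y2 <- <-; have := Ll 1 x1 y1; rewrite !scale1r.
by move=> i _; have := Ll (subset_sign S i * lcm_ratio (S :\ i) S) (f (S :\ i)) 0; rewrite !addr0 L0 addr0.
Qed.

(** The family g encodes the homomorphism from the free module T to V with value [g S] on the basis
    element S; this is its value at the chain c. *)
Definition pairing (V : lmodType R) (g : {set 'I_q} -> V) (c : {set 'I_q} -> R^o) : V :=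
  \sum_S c S *: g S.

(** Removing i from S matches the terms of the two sums. Facts on cochains can thus be read off from
    chains. *)
Lemma pairing_cob (V : lmodType R) (g : {set 'I_q} -> V) c :
  pairing (cob g) c = pairing g (bdy c).
Proof.
rewrite /pairing /cob /bdy; under eq_bigr do rewrite scaler_sumr.
under [RHS]eq_bigr do rewrite scaler_suml.
rewrite (exchange_big_dep predT) //= [RHS](exchange_big_dep predT) //=.
apply: eq_bigr => i _.
rewrite (reindex_onto (fun S : {set 'I_q} => i |: S) (fun S => S :\ i)) /=; last first.
  by move=> S iS; rewrite setD1K.
apply: eq_big => S.
  rewrite setU11 /=; apply/eqP/idP => [<-|iS]; first by rewrite !inE eqxx.
  by apply/setP => j; rewrite !inE; case: eqP => // ->; rewrite (negPf iS).
move=> /andP[_ /eqP E]; rewrite E scalerA -[subset_sign (i |: S) i]subset_signD1 E.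
by congr (_ *: _); rewrite mulrC.
Qed.

Definition unitc S : {set 'I_q} -> R^o := fun S' => (S' == S)%:R.

Lemma pairing_unitc (V : lmodType R) (g : {set 'I_q} -> V) S :
  pairing g (unitc S) = g S.
Proof.
rewrite /pairing (bigD1 S) //= /unitc eqxx scale1r big1 ?addr0 // => S' /negPf->.
by rewrite scale0r.
Qed.

Lemma cob_cob (V : lmodType R) (g : {set 'I_q} -> V) S : cob (cob g) S = 0.
Proof.
rewrite -pairing_unitc !pairing_cob /pairing big1 // => S' _.
by rewrite bdy_bdy scale0r.
Qed.

End Complex.

(** * Exactness of the Taylor complex *)

Section Exactness.
Variables (k : fieldType) (n q : nat) (mon : 'I_q -> 'X_{1..n}).
Local Notation R := {mpoly k[n]}.
Implicit Types (S : {set 'I_q}) (i j : 'I_q) (f : {set 'I_q} -> R).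
Local Notation lcmS := (lcmS mon).
Local Notation pure := (@pure k n q R^o).
Local Notation trunc := (@trunc k n q R^o).
Local Notation bdy := (@bdy k n q mon R^o).

(* Contracts the part of the complex in multidegrees divisible by [mon i].
   The quotient of the terms by the lcm is a shift of the exponents, in which
   the terms that would get a negative exponent are dropped. *)
Definition div_htpy i f S : R :=
  if i \in S then subset_sign k n S i * shift (lcmS S - lcmS (S :\ i)) (f (S :\ i)) else 0.

Lemma bdyE (f : {set 'I_q} -> R) S : bdy (f : {set 'I_q} -> R^o) S =
  \sum_(i | i \notin S) subset_sign k n S i * lcm_ratio k mon S (i |: S) * f (i |: S).
Proof. by []. Qed.

(** This cancels the off-diagonal terms of the homotopy formula. Exponents of lcms are maxima, so it
    is a coordinatewise check in truncated arithmetic. *)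
Lemma mulX_shift S i j (p : R) : 
  'X_[lcmS (j |: (i |: S)) - lcmS (i |: S)]
    * shift (lcmS (j |: (i |: S)) - lcmS (j |: S)) p =
  shift (lcmS (i |: S) - lcmS S) ('X_[lcmS (j |: S) - lcmS S] * p).
Proof.
apply/mpolyP => v; rewrite mcoeffXM !mcoeff_shift mcoeffXM.
have -> : (lcmS (j |: (i |: S)) - lcmS (i |: S) <= v)%MM
        = (lcmS (j |: S) - lcmS S <= v + (lcmS (i |: S) - lcmS S))%MM.
  by apply/mnm_lepP/mnm_lepP => le l; move: (le l);
    rewrite !(mnmDE, mnmBE, lcmSU1); lia.
case: ifP => // /mnm_lepP le; congr mcoeff; apply/mnmP => l; move: (le l).
by rewrite !(mnmDE, mnmBE, lcmSU1); lia.
Qed.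

(** The term of index i in one of the sums gives the right-hand side; the others vanish or cancel in
    pairs. For i outside S the right-hand side is the part of [f S] divisible by the ratio of lcms,
    hence zero when [f S] is. *)
Lemma div_htpyP i f S :
  bdy (div_htpy i f) S + div_htpy i (bdy f) S =
  if i \in S then f S
  else 'X_[lcmS (i |: S) - lcmS S] * shift (lcmS (i |: S) - lcmS S) (f S).
Proof.
rewrite {2}/div_htpy; case: ifP => iS; last first.
  rewrite addr0 bdyE (bigD1 i) ?iS //= big1 ?addr0; last first.
    move=> j /andP[_ ji]; rewrite /div_htpy !inE iS orbF eq_sym (negPf ji).
    by rewrite mulr0.
  rewrite /div_htpy setU11 setU1K ?iS // -[subset_sign k n (i |: S) i]subset_signD1 setU1K ?iS //.
  by rewrite mulrACA -mulrA mulrA subset_sign_sq mul1r.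
have [S' iS' ->] : exists2 S' : {set 'I_q}, i \notin S' & S = i |: S'.
  by exists (S :\ i); rewrite ?setD11 ?setD1K.
rewrite setU1K // -subset_signD1 setU1K // !bdyE shift_sum mulr_sumr.
rewrite [X in _ + X](bigD1 i) //= addrCA.
rewrite -mulrA {1}/subset_sign shift_signM -/(subset_sign k n S' i) mulrA subset_sign_sq mul1r.
rewrite shiftXM -[RHS]addr0; congr (_ + _).
rewrite [X in _ + X](eq_bigl (fun j => j \notin i |: S')); last first.
  by move=> j; rewrite !inE negb_or andbC.
rewrite -big_split big1 // => j; rewrite !inE negb_or => /andP[ji jS'] /=.
have -> : div_htpy i f (j |: (i |: S')) = subset_sign k n (j |: S') i * 
   shift (lcmS (j |: (i |: S')) - lcmS (j |: S')) (f (j |: S')).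
  rewrite setUCA /div_htpy setU11 -subset_signD1 setU1K //.
  by rewrite !inE eq_sym negb_or ji.
rewrite -mulrA mulrCA -mulrA mulrCA /lcm_ratio [X in subset_sign k n (i |: S') j * X]mulrCA.
rewrite mulX_shift [in X in _ + X]/subset_sign shift_signM -!/(subset_sign _ _ _ _).
rewrite !mulrA -mulrDl [X in X * _](_ : _ = 0) ?mul0r //.
rewrite !subset_signU1 // mulrACA [subset_sign _ _ S' j * _]mulrC -[X in _ + X]mul1r -mulrDl.
rewrite [X in X * _](_ : _ = 0) ?mul0r //.
have : i != j by rewrite eq_sym.
by case: ltngtP => [lt|lt|/val_inj->]; rewrite ?eqxx //= expr0 expr1 ?mul1r ?mulr1 addNr.
Qed.

(** Indices are treated one at a time: the homotopy of i clears the remainder on the subsets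
    containing i and, by [div_htpyP], leaves it zero wherever it was already zero. *)
Lemma bdy_exact_seq (r : seq 'I_q) f : bdy f =1 (fun=> 0) ->
  exists g, forall S, ((has (mem S) r) || (f S == 0)) -> f S = bdy g S.
Proof.
move=> f0.
suff [g gP]: exists g, forall S, f S - bdy g S = 0 \/ ~~ (has (mem S) r) && (f S != 0).
  by exists g => S; case: (gP S) => [/eqP|/andP[/negPf-> /negPf->]//];
    rewrite subr_eq0 => /eqP.
elim: r => [|i r [g gP]].
  exists (fun=> 0) => S; rewrite bdy0 subr0 /=.
  by case: (eqVneq (f S) 0) => [|_]; [left|right].
pose f' := fun S => f S - bdy g S.
have f'0 S : bdy f' S = 0 by rewrite bdyB bdy_bdy f0 subr0.
exists (fun S => g S + div_htpy i f' S) => S.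
have {}E : f S - bdy (fun S => g S + div_htpy i f' S) S = f' S - bdy (div_htpy i f') S.
  by rewrite bdyD opprD addrA.
rewrite E; have := div_htpyP i f' S.
have -> : div_htpy i (bdy f') S = 0.
  by rewrite /div_htpy f'0 shift0 mulr0 if_same.
rewrite addr0 => ->; case: ifP => iS; first by rewrite subrr; left.
case: (gP S) => [f'S|]; last by rewrite /= iS; right.
by rewrite /f' f'S shift0 mulr0 subr0; left.
Qed.

Lemma bdy_exact p f : pure p.+1 f -> bdy f =1 (fun=> 0) ->
  exists2 g, pure p.+2 g & forall S, bdy g S = f S.
Proof.
move=> pf f0; have [g gP] := bdy_exact_seq (enum 'I_q) f0.
exists (trunc p.+2 g); first exact: trunc_pure.
move=> S; rewrite bdy_trunc -(pure_trunc pf) /trunc; case: eqP => // Sp.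
apply/esym/gP/orP; left; apply/hasP.
have /card_gt0P[i iS] : (0 < #|S|)%N by rewrite Sp.
by exists i; rewrite ?mem_enum.
Qed.

End Exactness.

(** * Cochains with values in an injective resolution *)

(** Dividing A by the kernel of u makes u injective, and f descends to the quotient; both induced
    maps are computed on representatives. *)
Lemma injective_factor (R : comNzRingType) (E A B : lmodType R)
    (u : {linear A -> B}) (f : {linear A -> E}) :
  injective_module E -> (forall x, u x = 0 -> f x = 0) ->
  exists g : {linear B -> E}, forall x, g (u x) = f x.
Proof.
move=> Einj uf.
pose K : A -> bool := fun x => u x == 0.
have K_closed : submod_closed (K : {pred A}).
  split=> [|a x y]; rewrite !unfold_in /K ?linear0 // => /eqP ux /eqP uy.
  by rewrite linearP ux uy scaler0 addr0.
pose N : submodClosed A := HB.pack K (GRing.isSubmodClosed.Build R A K K_closed).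
have reprB x : repr (quot_pi N x) - x \in N.
  by apply/quot_pi_eq; rewrite quot_piK.
have ureprB x : u (repr (quot_pi N x)) = u x.
  by apply/eqP; rewrite -subr_eq0 -linearB; apply: reprB.
have frepr x : f (repr (quot_pi N x)) = f x.
  by apply/eqP; rewrite -subr_eq0 -linearB uf //; apply/eqP/reprB.
have lin (V : lmodType R) (h : {linear A -> V}) :
    (forall x, h (repr (quot_pi N x)) = h x) ->
    linear (fun x : quot_mod N => h (repr x)).
  move=> hr a x y; rewrite -[x]quot_piK -[y]quot_piK.
  have -> : a *: quot_pi N (repr x) = quot_pi N (a *: repr x).
    exact: quot_scale_pi.
  by rewrite -quot_piD !hr linearP.
pose i : {linear quot_mod N -> B} := HB.pack (fun x : quot_mod N => u (repr x))
  (GRing.isLinear.Build R _ _ _ _ (lin _ u ureprB)).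
pose h : {linear quot_mod N -> E} := HB.pack (fun x : quot_mod N => f (repr x))
  (GRing.isLinear.Build R _ _ _ _ (lin _ f frepr)).
have i_inj : injective i.
  move=> x y /= uxy; rewrite -[x]quot_piK -[y]quot_piK; apply/quot_pi_eq.
  by rewrite unfold_in /= /K linearB /= uxy subrr.
have [g gP] := Einj _ _ i h i_inj.
by exists g => x; rewrite -(ureprB x) -(frepr x); apply: (gP (quot_pi N x)).
Qed.

Section Taylor.
Variables (k : fieldType) (n q : nat) (mon : 'I_q -> 'X_{1..n}).
Local Notation R := {mpoly k[n]}.

(** All degrees together form one free module, so that the differential is an endomorphism to which
    [injective_factor] applies. *)
Definition taylor : lmodType R := {ffun {set 'I_q} -> R^o}.

Definition dT (c : taylor) : taylor := [ffun S => bdy mon c S].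

Lemma dT_linear : linear dT.
Proof.
move=> a x y; apply/ffunP => S; rewrite !ffunE -bdyZ -bdyD.
by apply: eq_bdy => S'; rewrite !ffunE.
Qed.

HB.instance Definition _ := GRing.isLinear.Build R taylor taylor _ dT dT_linear.

Lemma pairing_linear (V : lmodType R) (g : {set 'I_q} -> V) :
  linear (fun c : taylor => pairing g c).
Proof.
move=> a x y; rewrite /pairing scaler_sumr -big_split; apply: eq_bigr => S _.
by rewrite !ffunE scalerDl scalerA.
Qed.

Lemma eq_pairing (V : lmodType R) (g : {set 'I_q} -> V) (c c' : {set 'I_q} -> R^o) :
  c =1 c' -> pairing g c = pairing g c'.
Proof. by move=> cc'; apply: eq_bigr => S _; rewrite cc'. Qed.

Lemma pairing_trunc (V : lmodType R) p (g : {set 'I_q} -> V) (c : {set 'I_q} -> R^o) :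
  pure p g -> pairing g (trunc p c) = pairing g c.
Proof.
move=> pg; apply: eq_bigr => S _; rewrite /trunc; case: eqP => // /eqP/pg->.
by rewrite !scaler0.
Qed.

(** Hom(-, E) preserves exactness: the functional of g vanishes on the kernel of [dT], hence factors
    through [dT], and h lists the values of the factor on the basis. *)
Lemma cob_exact (E : lmodType R) p (g : {set 'I_q} -> E) :
  injective_module E -> pure p.+1 g -> cob mon g =1 (fun=> 0) ->
  exists2 h, pure p h & cob mon h =1 g.
Proof.
move=> Einj pg dg0.
pose G : {linear taylor -> E} := HB.pack (fun c : taylor => pairing g c)
  (GRing.isLinear.Build R _ _ _ _ (pairing_linear g)).
(* Only the component of degree p+1 of c matters to g. It is a boundary by [bdy_exact], and g, being
   a cocycle, vanishes on boundaries. *)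
have [c|H HP] := @injective_factor _ E taylor taylor dT G Einj.
  move=> /ffunP dc0; rewrite /= -(pairing_trunc _ pg).
  have [||b _ bP] := @bdy_exact k n q mon p (trunc p.+1 c).
  - exact: trunc_pure.
  - by move=> S; rewrite bdy_trunc trunc0 //; have := dc0 S; rewrite !ffunE.
  rewrite -(eq_pairing _ bP) -pairing_cob /pairing big1 // => S _.
  by rewrite dg0 scaler0.
pose h S := H [ffun S' => unitc k n S S'].
have HE (c : taylor) : H c = pairing h c.
  rewrite /pairing /h -[RHS](_ : H (\sum_S c S *: [ffun S' => unitc k n S S'] : taylor) = _).
    congr (H _); apply/ffunP => S; rewrite sum_ffunE (bigD1 S) //= big1 => [|S' S'S].
      by rewrite !ffunE /unitc eqxx addr0 /GRing.scale /= mulr1.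
    by rewrite !ffunE /unitc eq_sym (negPf S'S) scaler0.
  by rewrite linear_sum; apply: eq_bigr => S _; rewrite linearZ.
exists (trunc p h); first exact: trunc_pure.
move=> S; rewrite cob_trunc -(pure_trunc pg) /trunc; case: eqP => // _.
rewrite -pairing_unitc pairing_cob -(pairing_unitc g S).
transitivity (pairing h (dT [ffun S' => unitc k n S S'])).
  by apply: eq_pairing => S'; rewrite ffunE; apply: eq_bdy => S1; rewrite ffunE.
by rewrite -HE HP /=; apply: eq_pairing => S'; rewrite ffunE.
Qed.

End Taylor.

Section Resolution.
Variables (R : comNzRingType) (M : lmodType R) (E : injective_resolution M).

Lemma ires_injective i : injective_module (ires_mod E i).
Proof. by case: E. Qed.

Lemma ires_aug_inj : injective (ires_aug E).
Proof. by case: E. Qed.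

Lemma ires_exact0 x : ires_d E 0 x = 0 <-> exists m, x = ires_aug E m.
Proof. by case: E x. Qed.

Lemma ires_exactS i x : ires_d E i.+1 x = 0 <-> exists y, x = ires_d E i y.
Proof. by case: E x => /=. Qed.

Lemma ires_dd i x : ires_d E i.+1 (ires_d E i x) = 0.
Proof. by apply/ires_exactS; exists x. Qed.

Lemma ires_d_aug x : ires_d E 0 (ires_aug E x) = 0.
Proof. by apply/ires_exact0; exists x. Qed.

End Resolution.

Lemma ideal_pow_exp (R : comNzRingType) (a : ideal R) (r : R) N :
  r \in a -> ideal_pow a N (r ^+ N).
Proof.
move=> ra; elim: N => [|N IHN] //=; exists [:: (r, r ^+ N)].
by rewrite big_seq1 exprS; split=> // p; rewrite inE => /eqP->.
Qed.

Lemma torsion_annihilated (R : comNzRingType) (a : ideal R) (M : lmodType R) (x : M) :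
  (forall r, r \in a -> r *: x = 0) -> torsion a x.
Proof.
move=> ax; exists 1%N => r [s [sP ->]]; rewrite scaler_suml big1_seq // => p /andP[_ ps].
by rewrite mulrC -scalerA ax ?scaler0 //; case: (sP p ps).
Qed.

(** * Powers of the generators and the comparison map *)

Section Frobenius.
Variables (k : fieldType) (n q : nat) (mon : 'I_q -> 'X_{1..n}).
Local Notation R := {mpoly k[n]}.
Implicit Types (S : {set 'I_q}) (N : nat).

Definition scaled_mon N : 'I_q -> 'X_{1..n} := fun i => (mon i *+ N.+1)%MM.

Lemma lcmS_scaled_mon N S : lcmS (scaled_mon N) S = (lcmS mon S *+ N.+1)%MM.
Proof.
apply/mnmP => l; rewrite mulmnE !lcmSE.
under eq_bigr do rewrite mulmnE.
by rewrite (big_morph (muln^~ N.+1) (fun x y => maxnMl x y N.+1) (mul0n _)).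
Qed.

(** The dual of the comparison map from the Taylor complex of the (N+1)st powers to that of the
    monomials, which multiplies the basis element S by the N-th power of its lcm. *)
Definition lcm_scale (V : lmodType R) N (g : {set 'I_q} -> V) S : V :=
  'X_[lcmS mon S *+ N] *: g S.

Lemma lcmSD1_le i S : (lcmS mon (S :\ i) <= lcmS mon S)%MM.
Proof.
apply/mnm_lepP => l; rewrite !lcmSE; apply/bigmax_leqP => j /setD1P[_ jS].
by rewrite (bigop.bigmax_sup j).
Qed.

Lemma cob_lcm_scale (V : lmodType R) N (g : {set 'I_q} -> V) S :
  cob (scaled_mon N) (lcm_scale N g) S = lcm_scale N (cob mon g) S.
Proof.
rewrite /lcm_scale /cob scaler_sumr; apply: eq_bigr => i iS.
rewrite !scalerA mulrCA -mulrA; congr ((_ * _) *: _).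
rewrite /lcm_ratio !lcmS_scaled_mon -!mpolyXD; congr 'X_[_]; apply/mnmP => l.
have /mnm_lepP/(_ l) := lcmSD1_le i S.
rewrite !(mnmDE, mnmBE, mulmnE); nia.
Qed.

Lemma lcm_scale_pure (V : lmodType R) N p (g : {set 'I_q} -> V) : pure p g -> pure p (lcm_scale N g).
Proof. by move=> pg S Sp; rewrite /lcm_scale pg ?scaler0. Qed.

Hypothesis mon_sqfree : forall i, squarefree (mon i).

Lemma lcmS_sqfree S l : (lcmS mon S l <= 1)%N.
Proof. by rewrite lcmSE; apply/bigmax_leqP => i _; have /forallP := mon_sqfree i. Qed.

(* This is where squarefreeness is used: an exponent of the lcm that increases
   from [S :\ i] to [S] is zero at [S :\ i]. *)
Lemma shift_scaled_mon N S i (p : R) :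
  shift (lcmS mon S *+ N) ('X_[lcmS (scaled_mon N) S - lcmS (scaled_mon N) (S :\ i)] * p) =
  'X_[lcmS mon S - lcmS mon (S :\ i)] * shift (lcmS mon (S :\ i) *+ N) p.
Proof.
rewrite !lcmS_scaled_mon; apply/mpolyP => v; rewrite mcoeffXM !mcoeff_shift mcoeffXM.
have le l : (lcmS mon (S :\ i) l <= lcmS mon S l)%N by apply/mnm_lepP; apply: lcmSD1_le.
rewrite (_ : (_ <= v + _)%MM = (lcmS mon S - lcmS mon (S :\ i) <= v)%MM); last first.
  apply/mnm_lepP/mnm_lepP => + l => /(_ l); have := le l; have := lcmS_sqfree S l;
  rewrite !(mnmDE, mnmBE, mulmnE);
  by case: (lcmS mon S l) => [|[|//]]; case: (lcmS mon _ l) => [|[|//]]; lia.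
case: ifP => // /mnm_lepP le_v; congr mcoeff; apply/mnmP => l.
move: (le_v l) (le l) (lcmS_sqfree S l); rewrite !(mnmDE, mnmBE, mulmnE).
by case: (lcmS mon S l) => [|[|//]]; case: (lcmS mon _ l) => [|[|//]]; lia.
Qed.

(** Division by ['X_[lcmS mon S *+ N]] undoes [lcm_scale] and commutes with the differentials by
    [shift_scaled_mon], so it carries h to a primitive of f. *)
Lemma lcm_scale_cob_retract N p (f h : {set 'I_q} -> R^o) :
  pure p.+1 f -> cob (scaled_mon N) h =1 lcm_scale N f ->
  exists2 g, pure p g & cob mon g =1 f.
Proof.
move=> pf hf; pose g S : R^o := shift (lcmS mon S *+ N) (h S).
exists (trunc p g); first exact: trunc_pure.
move=> S; rewrite cob_trunc -(pure_trunc pf) /trunc; case: eqP => // _.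
transitivity (shift (lcmS mon S *+ N) (cob (scaled_mon N) h S) : R^o); last first.
  by rewrite hf /lcm_scale /GRing.scale /= shiftXM.
rewrite /cob shift_sum; apply: eq_bigr => i iS.
rewrite /GRing.scale /= -!mulrA [in RHS]/subset_sign shift_signM; congr (_ * _).
by rewrite /lcm_ratio shift_scaled_mon.
Qed.

End Frobenius.

(** * The chase in the double complex *)

Section Chase.
Variables (k : fieldType) (n q : nat) (mon : 'I_q -> 'X_{1..n}).
Local Notation R := {mpoly k[n]}.
Variable a : ideal R.
Hypothesis mon_a : forall i, 'X_[mon i] \in a.
Hypothesis a_mon : forall f, f \in a -> exists c : 'I_q -> R, f = \sum_i c i * 'X_[mon i].
Variable E : injective_resolution (R^o : lmodType R).
Local Notation d := (ires_d E).

Lemma lin_d i b x y : d i (b *: x + y) = b *: d i x + d i y.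
Proof. exact: linearP. Qed.

(* [g] is an element of Hom(T_p, E^(j+1)) killed by both differentials; for p = 0
   it is an element of E^(j+1) annihilated by [a]. *)
Lemma bicocycle_boundary p : forall j (g : {set 'I_q} -> ires_mod E j.+1),
  torsion_cohomology_eq0 a E (p + j).+1 ->
  pure p g -> cob mon g =1 (fun=> 0) -> (forall S, d j.+1 (g S) = 0) ->
  exists N, exists w : {set 'I_q} -> ires_mod E j,
    [/\ pure p w, cob (scaled_mon mon N) w =1 (fun=> 0)
      & forall S, lcm_scale mon N g S = d j (w S)].
Proof.
elim: p => [|p IHp] j g Hj pg dg0 g_d.
  have cf1 (m : 'I_q -> 'X_{1..n}) i : lcm_ratio k m set0 [set i] = 'X_[m i].
    rewrite /lcm_ratio lcmS0; congr 'X_[_]; apply/mnmP => l.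
    by rewrite mnmBE mnm0E subn0 lcmSE big_set1.
  have cob1 (V : lmodType R) m (h : {set 'I_q} -> V) i :
      cob m h [set i] = (subset_sign k n [set i] i * 'X_[m i]) *: h set0.
    by rewrite /cob big_set1 setDv cf1.
  have ax i : 'X_[mon i] *: g set0 = 0.
    have := dg0 [set i]; rewrite cob1 => /(congr1 (fun x => subset_sign k n [set i] i *: x)).
    by rewrite scalerA mulrA subset_sign_sq mul1r scaler0.
  (* For p = 0 the cocycle condition says that the generators kill [g set0]. It is therefore
     torsion, and the vanishing of local cohomology lifts it to a torsion element y. *)
  have [|y [[N yN] gy]] := Hj (g set0) _ (g_d _).
    apply: torsion_annihilated => r /a_mon[c ->]; rewrite scaler_suml big1 // => i _.
    by rewrite -scalerA ax scaler0.
  (* As [ideal_pow a N] kills y, so do the (N+1)st powers of the generators, and y is a cocycle for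
     [scaled_mon mon N]. At the empty set [lcm_scale] is the identity. *)
  exists N, (trunc 0 (fun=> y)); split; first exact: trunc_pure.
    move=> S; rewrite cob_trunc /trunc; case: eqP => // /eqP/cards1P[i ->].
    rewrite cob1 /scaled_mon -mpolyXn exprS -!scalerA.
    by rewrite (yN _ (ideal_pow_exp N (mon_a i))) !scaler0.
  move=> S; rewrite /trunc /lcm_scale cards_eq0; case: eqP => [->|/eqP S0].
    by rewrite -mpolyXn lcmS0 mpolyX0 expr1n scale1r.
  by rewrite pg ?scaler0 ?linear0 // cards_eq0.
(* With g = cob g', the cochain d g' is killed by both differentials; p drops by one and j rises by
   one, so the cohomological degree in the hypothesis is unchanged. *)
have [g' pg' gg'] := cob_exact (@ires_injective _ _ E _) pg dg0.
have [|||//|N [w [pw w0 gw]]] := IHp j.+1 (fun S => d j.+1 (g' S)).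
- by rewrite -addSnnS.
- by move=> S Sp; rewrite pg' ?linear0.
- by move=> S; rewrite cob_linear ?gg' //; apply: lin_d.
- by move=> S; apply: ires_dd.
(* As w is a cocycle, applying [cob] to this equation leaves the image of g under [lcm_scale], so
   [cob z] is the cochain sought. *)
have /fin_all_exists[z zP] S : exists z, lcm_scale mon N g' S - w S = d j z.
  by apply/ires_exactS; rewrite linearB /= -gw /lcm_scale linearZ subrr.
exists N, (trunc p.+1 (cob (scaled_mon mon N) z)); split; first exact: trunc_pure.
  move=> S; rewrite -(eq_cob _ (cob_trunc _ p z)).
  exact: cob_cob.
move=> S; rewrite -(pure_trunc (lcm_scale_pure mon N pg)) /trunc; case: eqP => [_|]; last by rewrite linear0.
rewrite -cob_linear; last exact: lin_d.
rewrite -(eq_cob _ zP) cobB w0 subr0 cob_lcm_scale /lcm_scale.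
by rewrite gg'.
Qed.

Hypothesis mon_sqfree : forall i, squarefree (mon i).

(** The chase is run along the augmentation: it makes the image of f under [lcm_scale] a coboundary
    with values in R, and the retraction brings the primitive back to the original complex. *)
Lemma taylor_dual_exact p (f : {set 'I_q} -> R^o) :
  torsion_cohomology_eq0 a E p.+1 -> pure p.+1 f -> cob mon f =1 (fun=> 0) ->
  exists2 g, pure p g & cob mon g =1 f.
Proof.
move=> Hp pf f0.
have lin_aug b x y : ires_aug E (b *: x + y) = b *: ires_aug E x + ires_aug E y.
  exact: linearP.
pose F S := ires_aug E (f S).
have pF : pure p.+1 F by move=> S Sp; rewrite /F pf ?linear0.
have F0 : cob mon F =1 (fun=> 0) by move=> S; rewrite cob_linear // f0 linear0.
have [g pg gF] := cob_exact (@ires_injective _ _ E _) pF F0.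
have [||||N [w [pw w0 gw]]] := @bicocycle_boundary p 0 (fun S => d 0 (g S)).
- by rewrite addn0.
- by move=> S Sp; rewrite pg ?linear0.
- by move=> S; rewrite cob_linear ?gF ?ires_d_aug //; apply: lin_d.
- by move=> S; apply: ires_dd.
have /fin_all_exists[z zP] S : exists z, lcm_scale mon N g S - w S = ires_aug E z.
  by apply/ires_exact0; rewrite linearB /= -gw /lcm_scale linearZ subrr.
apply: (@lcm_scale_cob_retract _ _ _ _ mon_sqfree N p f z pf) => S.
apply: (@ires_aug_inj _ _ E); rewrite -cob_linear //.
rewrite -(eq_cob _ zP) cobB w0 subr0 cob_lcm_scale /lcm_scale gF.
by rewrite linearZ.
Qed.

End Chase.

(** * Splitting the Taylor complex above the cohomological dimension *)

Section Splitting.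
Variables (k : fieldType) (n q : nat) (mon : 'I_q -> 'X_{1..n}).
Local Notation R := {mpoly k[n]}.
Local Notation cochain := ({set 'I_q} -> R^o).
Local Notation taylor := (taylor k n q).
Local Notation unitc := (@unitc k n q).
Variable c : nat.
Hypothesis cob_exact_above : forall p (f : cochain), (c <= p)%N ->
  pure p.+1 f -> cob mon f =1 (fun=> 0) -> exists2 g : cochain, pure p g & cob mon g =1 f.

(** The value at f of the linear map sending the basis cochain [unitc S] to [t S]. *)
Definition lincomb (t : {set 'I_q} -> cochain) (f : cochain) : cochain :=
  fun U => \sum_S f S *: t S U.

Lemma cob_lincomb t f U : cob mon (lincomb t f) U = lincomb (fun S => cob mon (t S)) f U.
Proof.
rewrite /cob /lincomb; under eq_bigr do rewrite scaler_sumr.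
rewrite exchange_big; apply: eq_bigr => S _; rewrite scaler_sumr.
by apply: eq_bigr => i _; rewrite !scalerA mulrC.
Qed.

Lemma lincomb_unitc f U : lincomb unitc f U = f U.
Proof.
rewrite /lincomb (bigD1 U) //= big1 => [|S SU]; rewrite /unitc ?eqxx.
  by rewrite addr0 /GRing.scale /= mulr1.
by rewrite eq_sym (negPf SU) scaler0.
Qed.

(* Descending induction on j: the differential has a section on the cocycles of
   degree j, starting from j > q where there are no cochains. *)
Lemma partial_contraction m j : (c < j)%N -> (q < j + m)%N ->
  exists t, forall f : cochain, pure j f -> cob mon f =1 (fun=> 0) ->
    cob mon (lincomb t f) =1 f.
Proof.
elim: m j => [|m IHm] j cj qj.
  exists (fun _ _ => 0) => f pf _ S; rewrite cob_lincomb [RHS]pf; last first.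
    by have := subset_leq_card (subsetT S); rewrite cardsT card_ord; lia.
  by rewrite /lincomb big1 // => S' _; rewrite /cob big1 ?scaler0 // => i _; rewrite scaler0.
have [||s sP] := IHm j.+1; [lia|lia|].
case: j cj qj sP => // j cj qj sP.
(* Since s is a section one degree higher, z projects onto the cocycles and fixes each cocycle f,
   where [cob f] is zero. Lifting the values of z on the basis gives t. The truncations are there
   because s is not known to respect degrees. *)
pose z S : cochain := fun U => unitc S U - lincomb s (cob mon (unitc S)) U.
have pu (S : {set 'I_q}) : #|S| = j.+1 -> pure j.+1 (unitc S).
  by move=> Sj U; rewrite /unitc; case: (eqVneq U S) => // ->; rewrite Sj eqxx.
have /fin_all_exists[t tP] (S : {set 'I_q}) :
    exists t, #|S| = j.+1 -> cob mon t =1 trunc j.+1 (z S).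
  case: (eqVneq #|S| j.+1) => [Sj|]; last by move=> ne; exists (fun=> 0) => /eqP; rewrite (negPf ne).
  have [|||g _ gP] := @cob_exact_above j (trunc j.+1 (z S)) => //.
  - exact: trunc_pure.
  - move=> U; rewrite cob_trunc trunc0 // cobB sP ?subrr //.
      exact/cob_pure/pu.
    exact: cob_cob.
  by exists g.
exists t => f pf f0 U; rewrite cob_lincomb.
transitivity (trunc j.+1 (fun U => lincomb z f U) U); last first.
  rewrite -(pure_trunc pf) /trunc; case: eqP => // _.
  rewrite -[RHS]subr0 -[in RHS](lincomb_unitc f) /lincomb /z.
  under eq_bigr do rewrite scalerBr.
  rewrite sumrB; congr (_ - _).
  under eq_bigr do rewrite /lincomb scaler_sumr.
  rewrite exchange_big big1 // => S _ /=.
  under eq_bigr do rewrite scalerA.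
  rewrite -scaler_suml [X in X *: _](_ : _ = 0) ?scale0r //.
  transitivity (lincomb (fun S0 => cob mon (unitc S0)) f S) => //.
  by rewrite -cob_lincomb (eq_cob _ (lincomb_unitc f)) f0.
rewrite /trunc; case: ifP => Uj.
  apply: eq_bigr => S _; case: (eqVneq #|S| j.+1) => [/tP->|/pf->]; last by rewrite !scale0r.
  by rewrite /trunc Uj.
rewrite /lincomb big1 // => S _; case: (eqVneq #|S| j.+1) => [/tP->|/pf->]; last by rewrite scale0r.
by rewrite /trunc Uj scaler0.
Qed.

(** Take eps = 1 - d sigma in degree c, with sigma the transpose of the section t. It factors
    through T_c / d T_(c+1) and induces the identity there, which makes this cokernel a direct
    summand of T_c. *)
Lemma taylor_splitting : exists eps : {linear taylor -> taylor},
  (forall x : taylor, pure c.+1 x -> eps (dT mon x) = 0) /\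
  (forall x : taylor, pure c x -> exists y, x - eps x = dT mon y).
Proof.
have [||t tP] := @partial_contraction q c.+1; [lia|lia|].
pose sigma (x : taylor) : taylor := [ffun S => pairing (t S) x].
have sigma_lin : linear sigma.
  by move=> a x y; apply/ffunP => S; rewrite !ffunE pairing_linear.
pose e (x : taylor) : taylor := [ffun S => trunc c (x - dT mon (sigma x)) S].
have e_lin : linear e.
  move=> a x y; apply/ffunP => S; rewrite !ffunE /trunc !ffunE.
  case: ifP => _; last by rewrite scaler0 addr0.
  have /ffunP/(_ S) : dT mon (sigma (a *: x + y)) = a *: dT mon (sigma x) + dT mon (sigma y).
    by rewrite sigma_lin dT_linear.
  rewrite !ffunE => ->.
  by rewrite scalerBr opprD addrACA.
pose eps : {linear taylor -> taylor} := HB.pack e (GRing.isLinear.Build R _ _ _ _ e_lin).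
exists eps; split=> x px /=; last first.
  exists [ffun S => trunc c.+1 (sigma x) S]; apply/ffunP => U; rewrite !ffunE.
  rewrite (eq_bdy _ (g := trunc c.+1 (sigma x))); last by move=> S; rewrite ffunE.
  rewrite bdy_trunc /trunc; case: eqP => [_|/eqP/px->]; last by rewrite subr0.
  by rewrite !ffunE opprB addrC subrK.
apply/ffunP => U; rewrite !ffunE /trunc; case: eqP => // Uc; apply/eqP.
have pu : pure c (unitc U).
  by move=> S; rewrite /unitc; case: (eqVneq S U) => // ->; rewrite Uc eqxx.
rewrite !ffunE subr_eq0 -[X in _ == X]lincomb_unitc -[X in X == _]lincomb_unitc; apply/eqP.
have comm (g h : cochain) : pairing g h = \sum_S g S *: h S.
  by apply: eq_bigr => S _; rewrite /GRing.scale /= mulrC.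
have appE (h : cochain) : lincomb unitc h U = pairing h (unitc U).
  by rewrite pairing_unitc lincomb_unitc.
have symp (g h : cochain) : pairing g h = pairing h g by rewrite comm.
rewrite !appE symp [RHS]symp -!pairing_cob.
(* The claim is d sigma d = d. Paired with a basis cochain, it becomes the section property of t on
   the cocycle [cob mon (unitc U)]. *)
have -> : pairing (cob mon (unitc U)) x = pairing (cob mon (lincomb t (cob mon (unitc U)))) x.
  rewrite symp [RHS]symp; apply: eq_pairing => S; rewrite tP //; last exact: cob_cob.
  exact: cob_pure.
rewrite pairing_cob /pairing /lincomb.
under eq_bigr do rewrite scaler_sumr.
rewrite exchange_big; apply: esym; apply: eq_bigr => S _.
rewrite ffunE /pairing scaler_suml; apply: eq_bigr => S' _.
rewrite ffunE !scalerA; apply: etrans (mulrC _ _) _.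
by rewrite /GRing.scale /= mulrCA mulrA.
Qed.

End Splitting.

(** * Koszul homology *)

Section Koszul.
Variables (k : fieldType) (n : nat).
Local Notation R := {mpoly k[n]}.

(* The Koszul complex of the variables is their Taylor complex. *)
Definition var_mon (i : 'I_n) : 'X_{1..n} := U_(i)%MM.
Local Notation kos := (bdy var_mon).

Lemma eval_taylor_linear q (S : {set 'I_q}) a (x y : taylor k n q) :
  (a *: x + y) S = a *: x S + y S.
Proof. by rewrite !ffunE. Qed.

Lemma koszul_exact_taylor q p (F : {set 'I_n} -> taylor k n q) :
  pure p.+1 F -> kos F =1 (fun=> 0) ->
  exists2 G : {set 'I_n} -> taylor k n q, pure p.+2 G & kos G =1 F.
Proof.
move=> pF F0.
have /fin_all_exists[g gP] (S' : {set 'I_q}) : exists g : {set 'I_n} -> R^o,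
    pure p.+2 g /\ kos g =1 (fun S => F S S').
  have [||g pg gP] := @bdy_exact k n n var_mon p (fun S => F S S').
  - by move=> S Sp; rewrite pF // ffunE.
  - move=> S; rewrite (bdy_linear _ _ _ (eval_taylor_linear S')) F0.
    by rewrite ffunE.
  by exists g.
exists (fun S => [ffun S' => g S' S]) => [S Sp|S]; apply/ffunP => S'; rewrite ?ffunE.
  by rewrite (gP S').1.
rewrite -(bdy_linear _ _ _ (eval_taylor_linear S')) -(gP S').2.
by apply: eq_bdy => T; rewrite ffunE.
Qed.

Section Coker.
Variables (q : nat) (mon : 'I_q -> 'X_{1..n}).
Local Notation taylor := (taylor k n q).
Local Notation d := (dT mon).

Lemma kos_dT (F : {set 'I_n} -> taylor) S : kos (fun S => d (F S)) S = d (kos F S).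
Proof. by apply: bdy_linear => a x y; rewrite linearP. Qed.

Lemma dT_dT (x : taylor) : d (d x) = 0.
Proof.
apply/ffunP => S; rewrite !ffunE -[RHS](bdy_bdy mon x S).
by apply: eq_bdy => S'; rewrite ffunE.
Qed.

(* H_i(x; T_j / d T_(j+1)) = 0 for i > e. *)
Definition koszul_coker_vanish j e := forall i (F W : {set 'I_n} -> taylor),
  (e <= i)%N -> pure i.+1 F -> pure i W ->
  (forall S, pure j (F S)) -> (forall S, pure j.+1 (W S)) ->
  (forall S, kos F S = d (W S)) ->
  exists G W' : {set 'I_n} -> taylor,
    pure i.+2 G /\ forall S, F S - kos G S = d (W' S).

(** A direct summand of a free module has no higher Koszul homology: eps F is a genuine Koszul cycle
    with values in T, hence a boundary, and it differs from F by values of d. *)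
Lemma koszul_coker_top c (eps : {linear taylor -> taylor}) :
  (forall x : taylor, pure c.+1 x -> eps (d x) = 0) ->
  (forall x : taylor, pure c x -> exists y, x - eps x = d y) ->
  koszul_coker_vanish c 0.
Proof.
move=> eps_d eps_id i F W _ pF _ cF cW FW.
have lin_eps a x y : eps (a *: x + y) = a *: eps x + eps y by exact: linearP.
have [|S|G pG GP] := @koszul_exact_taylor q i (fun S => eps (F S)).
- by move=> S Sp; rewrite pF ?linear0.
- by rewrite bdy_linear // FW eps_d.
have /fin_all_exists[y yP] S : exists y, F S - eps (F S) = d y by exact: eps_id.
by exists G, y; split=> // S; rewrite GP.
Qed.

(** Dimension shift along 0 -> T_(j+1)/d T_(j+2) -> T_j -> T_j/d T_(j+1) -> 0, exact because the
    Taylor complex is; the middle term is free. *)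
Lemma koszul_coker_step j e :
  koszul_coker_vanish j.+1 e -> koszul_coker_vanish j e.+1.
Proof.
move=> IH [//|i] F W ei pF pW cF cW FW.
have cZ S : pure j.+1 (kos W S).
  move=> S' /cW W0; rewrite -(bdy_linear _ _ _ (eval_taylor_linear S')).
  by rewrite /bdy big1 // => l _; rewrite W0 scaler0.
have dZ S : d (kos W S) = 0.
  by rewrite -kos_dT -(eq_bdy _ FW) bdy_bdy.
have /fin_all_exists[V VP] S : exists V : taylor, pure j.+2 V /\ d V = kos W S.
  have [||g pg gP] := @bdy_exact k n q mon j (kos W S) => //.
    by move=> S'; have /ffunP/(_ S') := dZ S; rewrite !ffunE.
  exists [ffun S' => g S']; split=> [S' Sp|]; first by rewrite ffunE pg.
  by apply/ffunP => S'; rewrite ffunE -gP; apply: eq_bdy => T; rewrite ffunE.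
have [||||||G [W' [pG GW]]] := IH i W (trunc i V).
- by [].
- by [].
- exact: trunc_pure.
- by [].
- by move=> S; rewrite /trunc; case: eqP => _ T Tj; rewrite ?(VP S).1 ?ffunE.
- move=> S; rewrite -(pure_trunc (bdy_pure var_mon pW)) /trunc; case: eqP => _.
    by rewrite (VP S).2.
  by rewrite linear0.
(* Correcting F by d G gives a Koszul cycle with values in the free module itself. *)
have [||H pH HP] := @koszul_exact_taylor q i.+1 (fun S => F S - d (G S)).
- by move=> S Sp; rewrite (pF _ Sp) (pG _ Sp) sub0r linear0 oppr0.
- by move=> S; rewrite bdyB kos_dT FW -linearB /= GW dT_dT.
by exists H, G; split=> // S; rewrite HP subKr.
Qed.

End Coker.

End Koszul.

Section QuotientKoszul.
Variables (k : fieldType) (n q : nat) (mon : 'I_q -> 'X_{1..n}).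
Local Notation R := {mpoly k[n]}.
Local Notation kos := (bdy (@var_mon n)).

(* H_i(x; R/B) = 0 for i > e. *)
Definition koszul_quot_vanish (B : R -> Prop) e := forall i (F : {set 'I_n} -> R^o),
  (e <= i)%N -> pure i.+1 F -> (forall S, B (kos F S)) ->
  exists2 G : {set 'I_n} -> R^o, pure i.+2 G & forall S, B (F S - kos G S).

(** R/B is T_0 / d T_1: [inc] places R at the empty set, and d on singletons produces the multiples
    of the monomials. *)
Lemma koszul_quot_coker (B : R -> Prop) e :
  (forall f, B f <-> exists c : 'I_q -> R, f = \sum_i c i * 'X_[mon i]) ->
  koszul_coker_vanish k mon 0 e -> koszul_quot_vanish B e.
Proof.
move=> BP HK i F ei pF BF.
pose inc (x : R^o) : taylor k n q := [ffun S => if S == set0 then x else 0].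
have inc_lin a x y : inc (a *: x + y) = a *: inc x + inc y.
  by apply/ffunP => S; rewrite !ffunE; case: ifP => // _; rewrite scaler0 addr0.
have inc0 : inc 0 = 0 by apply/ffunP => S; rewrite !ffunE if_same.
have dE (w : taylor k n q) : dT mon w set0 = \sum_i w [set i] * 'X_[mon i].
  rewrite ffunE /bdy; under eq_bigl do rewrite inE.
  apply: eq_bigr => l _; have -> : subset_sign k n set0 l = 1.
    rewrite /subset_sign (_ : [set _ in set0 | _] = set0) ?cards0 //.
    by apply/setP => x; rewrite !inE.
  rewrite mul1r setU0 /lcm_ratio lcmS0; apply: etrans (mulrC _ _) _.
  congr (_ * 'X_[_]); apply/mnmP => z.
  by rewrite mnmBE mnm0E subn0 lcmSE big_set1.
have incB x : B x -> exists w : taylor k n q, pure 1 w /\ inc x = dT mon w.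
  move=> /BP[c ->]; exists [ffun S : {set 'I_q} => \sum_i (S == [set i])%:R * c i : R^o].
  split=> [S S1|].
    rewrite ffunE big1 // => l _; case: (eqVneq S [set l]) S1 => [->|_ _]; last by rewrite mul0r.
    by rewrite cards1.
  apply/ffunP => S; rewrite [LHS]ffunE; case: ifP => [/eqP->|/negP S0].
    rewrite dE; apply: eq_bigr => l _; rewrite ffunE; congr (_ * _).
    rewrite (bigD1 l) //= eqxx mul1r big1 ?addr0 // => l' l'l.
    by rewrite (inj_eq set1_inj) eq_sym (negPf l'l) mul0r.
  rewrite ffunE /bdy big1 // => l lS; rewrite ffunE big1 ?scaler0 // => l' _.
  case: eqP => [E|_]; last by rewrite mul0r.
  case: S0; rewrite -cards_eq0; have := congr1 (fun A : {set 'I_q} => #|A|) E.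
  by rewrite cards1 cardsU1 lS => ?; apply/eqP; lia.
have /fin_all_exists[W WP] S : exists w : taylor k n q, pure 1 w /\ inc (kos F S) = dT mon w.
  exact: incB.
have [||||||G [W' [pG GW]]] := HK i (fun S => inc (F S)) (trunc i W).
- by [].
- by move=> S Sp; rewrite pF.
- exact: trunc_pure.
- by move=> S S' S'0; rewrite ffunE -cards_eq0 (negPf S'0).
- by move=> S; rewrite /trunc; case: eqP => _ T Tj; rewrite ?(WP S).1 ?ffunE.
- move=> S; rewrite bdy_linear //.
  rewrite -(pure_trunc (bdy_pure (@var_mon n) pF)) /trunc; case: eqP => _; last by rewrite inc0 linear0.
  exact: (WP S).2.
exists (fun S => G S set0) => [S Sp|S]; first by rewrite pG // ffunE.
have /ffunP/(_ set0) := GW S; rewrite dE !ffunE eqxx.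
rewrite (bdy_linear _ _ _ (eval_taylor_linear set0)) => ->.
by apply/BP; exists (fun i => W' S [set i]).
Qed.

End QuotientKoszul.

(** * Noetherianity of polynomial rings *)

(** Otherwise choice yields an infinite sequence in L with no term in relation D to the list of its
    predecessors. D will be divisibility of monomials, then membership in an ideal. *)
Lemma finite_basis (T : eqType) (L : T -> Prop) (D : seq T -> T -> Prop) :
  (forall u : nat -> T, exists i, D (mkseq u i) (u i)) ->
  exists s, (forall x, x \in s -> L x) /\ forall x, L x -> D s x.
Proof.
move=> uD; apply: NNPP => noS.
have next s : {x | (forall y, y \in s -> L y) -> L x /\ ~ D s x}.
  apply: constructive_indefinite_description; apply: NNPP => noX; apply: noS.
  exists s; split=> [y ys|x Lx]; apply: NNPP => H; apply: noX.
    by exists y => /(_ y ys).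
  by exists x.
pose st := fix st i := if i is j.+1 then rcons (st j) (sval (next (st j))) else [::].
pose u i := sval (next (st i)).
have stE i : st i = mkseq u i.
  by elim: i => // i IH; rewrite mkseqS -IH.
have stL i : forall y, y \in st i -> L y.
  elim: i => //= i IH y; rewrite mem_rcons inE => /orP[/eqP->|/IH//].
  by case: (next (st i)) => x /= /(_ IH)[].
have [i] := uD u; rewrite -stE /u; by case: (next (st i)) => x /= /(_ (stL i))[].
Qed.

Lemma tail_min (v : nat -> nat) N : exists2 i, (N <= i)%N & forall j, (N <= j)%N -> (v i <= v j)%N.
Proof.
suff H : forall m i, (N <= i)%N -> (v i <= m)%N ->
    exists2 i, (N <= i)%N & forall j, (N <= j)%N -> (v i <= v j)%N.
  exact: (H (v N) N (leqnn _) (leqnn _)).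
elim=> [|m IH] i Ni vi; first by exists i => // j _; lia.
apply: NNPP => H; apply: (H); exists i => // j Nj; apply: contraT => lt.
by exfalso; apply: H; apply: (IH j) => //; lia.
Qed.

Lemma nondecreasing_subseq (v : nat -> nat) : exists phi : nat -> nat,
  (forall i j, (i < j)%N -> (phi i < phi j)%N) /\
  (forall i j, (i <= j)%N -> (v (phi i) <= v (phi j))%N).
Proof.
have mn N : {i | (N <= i)%N /\ forall j, (N <= j)%N -> (v i <= v j)%N}.
  by apply: constructive_indefinite_description; have [i] := tail_min v N; exists i.
pose phi := fix phi i := if i is j.+1 then sval (mn (phi j).+1) else sval (mn 0).
have phiS i : (phi i < phi i.+1)%N by rewrite /=; case: (mn _) => ? [].
have phi_lt i j : (i < j)%N -> (phi i < phi j)%N.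
  elim: j => // j IH; rewrite ltnS leq_eqVlt => /orP[/eqP->//|/IH lt].
  exact: ltn_trans lt (phiS j).
have phi_min i j : (phi i <= j)%N -> (v (phi i) <= v j)%N.
  by case: i => [|i] /=; case: (mn _) => x [/= Nx H] xj; apply: H; lia.
exists phi; split=> // i j; rewrite leq_eqVlt => /orP[/eqP->//|/phi_lt lt].
exact/phi_min/ltnW.
Qed.

(** Passing to a subsequence for each coordinate in turn makes all coordinates nondecreasing; its
    first two terms then divide as required. *)
Lemma dickson_seq n (u : nat -> 'X_{1..n}) :
  exists i, has (fun m => (m <= u i)%MM) (mkseq u i).
Proof.
have [phi [lt_phi le_phi]] : exists phi : nat -> nat,
    (forall i j, (i < j)%N -> (phi i < phi j)%N) /\
    forall l, l \in enum 'I_n -> forall i j, (i <= j)%N -> (u (phi i) l <= u (phi j) l)%N.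
  elim: (enum 'I_n) => [|l r [phi [lt_phi le_phi]]]; first by exists id.
  have [psi [lt_psi le_psi]] := nondecreasing_subseq (fun i => u (phi i) l).
  exists (phi \o psi); split=> [i j ij|l']; first exact/lt_phi/lt_psi.
  rewrite inE => /orP[/eqP->//|lr] i j ij; apply: le_phi => //.
  by case: (ltngtP i j) ij => // [/lt_psi/ltnW|->].
exists (phi 1%N); apply/hasP; exists (u (phi 0%N)).
  by apply/mapP; exists (phi 0%N) => //; rewrite mem_iota /= add0n lt_phi.
by apply/mnm_lepP => l; apply: le_phi; rewrite ?mem_enum.
Qed.

Section Ideals.
Variable R : comNzRingType.
Implicit Types (B : R -> Prop) (s : seq R).

Definition is_ideal B := B 0 /\ forall a x y, B x -> B y -> B (a * x + y).

Section Closure.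
Variables (B : R -> Prop) (Bid : is_ideal B).

Lemma ideal0 : B 0. Proof. by case: Bid. Qed.

Lemma idealM a x : B x -> B (a * x).
Proof. by move=> Bx; rewrite -[a * x]addr0; apply: Bid.2 Bx _; case: Bid. Qed.

Lemma idealD x y : B x -> B y -> B (x + y).
Proof. by move=> Bx By; rewrite -[x]mul1r; apply: Bid.2. Qed.

Lemma idealN x : B x -> B (- x).
Proof. by rewrite -mulN1r; apply: idealM. Qed.

Lemma idealB x y : B x -> B y -> B (x - y).
Proof. by move=> Bx By; apply: idealD Bx (idealN By). Qed.

Lemma ideal_sum (I : Type) (r : seq I) (P : pred I) (F : I -> R) :
  (forall i, P i -> B (F i)) -> B (\sum_(i <- r | P i) F i).
Proof. by move=> BF; apply: big_ind => //; [apply: ideal0 | apply: idealD]. Qed.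

Lemma colon_ideal b : is_ideal (fun z => B (z * b)).
Proof.
split=> [|a x y Bx By]; first by rewrite mul0r; apply: ideal0.
by rewrite mulrDl -mulrA; apply: idealD => //; apply: idealM.
Qed.

End Closure.

(** The ideal generated by s, as an intersection of ideals, so that no coefficients have to be
    carried along. *)
Definition in_span s f := forall B, is_ideal B -> (forall x, x \in s -> B x) -> B f.

Lemma mem_in_span s x : x \in s -> in_span s x.
Proof. by move=> xs B _; apply. Qed.

Lemma in_span_ideal s : is_ideal (in_span s).
Proof.
by split=> [B [] //|a x y sx sy B Bid sB]; apply: Bid.2; [apply: sx | apply: sy].
Qed.

Lemma in_span_sub s s' f : {subset s <= s'} -> in_span s f -> in_span s' f.
Proof. by move=> ss sf B Bid sB; apply: sf => // x /ss/sB. Qed.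

Lemma generated_by_ideal s : is_ideal (generated_by s).
Proof.
split=> [|a x y [cx ->] [cy ->]].
  by exists (fun=> 0); rewrite big1 // => i _; rewrite mul0r.
exists (fun i => a * cx i + cy i); rewrite mulr_sumr -big_split.
by apply: eq_bigr => i _; rewrite mulrDl mulrA.
Qed.

Lemma mem_generated_by s x : x \in s -> generated_by s x.
Proof.
move=> xs; have lt : (index x s < size s)%N by rewrite index_mem.
exists (fun i => (i == Ordinal lt)%:R).
rewrite (bigD1 (Ordinal lt)) //= eqxx mul1r nth_index // big1 ?addr0 // => i /negPf->.
by rewrite mul0r.
Qed.

Lemma generated_by_sub s B f : is_ideal B -> (forall x, x \in s -> B x) ->
  generated_by s f -> B f.
Proof.
move=> Bid sB [c ->]; apply: ideal_sum => // i _; apply: idealM => //.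
by apply: sB; rewrite mem_nth.
Qed.

End Ideals.

(** Gröbner basis argument: by Dickson, finitely many leading monomials of the ideal I of all the z
    i suffice; polynomials realizing them lie in the span of the first K terms, and division shows
    that this span is all of I. *)
Lemma mpoly_noetherian (k : fieldType) n (z : nat -> {mpoly k[n]}) :
  exists i, in_span (mkseq z i) (z i).
Proof.
pose I f := exists i, in_span (mkseq z i) f.
have mono i j : (i <= j)%N -> {subset mkseq z i <= mkseq z j}.
  move=> ij x /mapP[l]; rewrite mem_iota => /= li ->; apply: map_f.
  by rewrite mem_iota /=; lia.
pose L m := exists2 f, I f & f != 0 /\ mlead f = m.
pose D (r : seq 'X_{1..n}) (m : 'X_{1..n}) : Prop := has (fun m' => (m' <= m)%MM) r.
have [s [sL Ls]] := @finite_basis _ L D (@dickson_seq n).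
have [K KP] : exists K, forall m, m \in s ->
    exists2 f, in_span (mkseq z K) f & f != 0 /\ mlead f = m.
  elim: s sL {Ls} => [|m s IH] sL; first by exists 0%N.
  have [|K KP] := IH; first by move=> x xs; apply: sL; rewrite inE xs orbT.
  have [|f [i fi] fm] := sL m; first by rewrite inE eqxx.
  exists (maxn K i) => x; rewrite inE => /orP[/eqP->|/KP[g gK gx]].
    by exists f => //; apply: in_span_sub fi; apply/mono/leq_maxr.
  by exists g => //; apply: in_span_sub gK; apply/mono/leq_maxl.
exists K; have : I (z K).
  by exists K.+1; apply: mem_in_span; apply: map_f; rewrite mem_iota /= add0n ltnS.
move: (z K) => f; move: {2}(mlead f) (erefl (mlead f)) => m.
(* Subtracting a multiple of a basis element cancels the leading term, so the induction is on the
   leading monomial. *)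
elim/(well_founded_induction (@ltom_wf n)): m f => m IH f fm If.
have [->|f0] := eqVneq f 0; first exact: ideal0 (in_span_ideal _).
have /Ls/hasP[m0 /KP[g gK [g0 gm]] le_m] : L m by exists f.
pose c := f@_m / g@_m0; pose h : {mpoly k[n]} := 'X_[m - m0] * g.
have hK : in_span (mkseq z K) (c%:MP * h).
  by apply: (idealM (in_span_ideal _)); apply: (idealM (in_span_ideal _)).
rewrite -[f](subrK (c%:MP * h)); apply: (idealD (in_span_ideal _)) => //.
have hm : mlead h = m.
  rewrite /h mleadM //; last by rewrite -msupp_eq0 msuppX.
  by rewrite (mleadXm k) gm submK.
have lc0 : (f - c%:MP * h)@_m = 0.
  rewrite mcoeffB mcoeffCM mcoeffXM lem_subr.
  have -> : (m - (m - m0))%MM = m0.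
    by apply/mnmP => l; rewrite !mnmBE; have /mnm_lepP/(_ l) := le_m; lia.
  by rewrite divfK ?subrr // -gm mleadc_eq0.
have [->|d0] := eqVneq (f - c%:MP * h) 0; first exact: ideal0 (in_span_ideal _).
apply: (IH (mlead (f - c%:MP * h)) _ _ erefl).
  rewrite lt_neqAle; apply/andP; split.
    by apply: contraNneq d0 => E; rewrite -mleadc_eq0 E lc0.
  apply: le_trans (mleadB_le _ _) _; rewrite leUx fm lexx /= mul_mpolyC.
  by rewrite (le_trans (mleadZ_le _ _)) ?hm.
case: If => i fi; exists (maxn i K); apply: (idealB (in_span_ideal _)).
  by apply: in_span_sub fi; apply/mono/leq_maxl.
by apply: in_span_sub hK; apply/mono/leq_maxr.
Qed.

(** * Zero divisors modulo an ideal *)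

Section ZeroDivisors.
Variable R : comNzRingType.
Hypothesis noeth : forall z : nat -> R, exists i, in_span (mkseq z i) (z i).
Variables (B : R -> Prop) (Bid : is_ideal B).

(* The colon ideal (B : b) is maximal among those of elements outside B, hence
   an associated prime of R/B. *)
Definition max_colon b := ~ B b /\ forall b', ~ B b' ->
  (forall z, B (z * b) -> B (z * b')) -> forall z, B (z * b') -> B (z * b).

(** Otherwise there is a strictly increasing chain of colon ideals, with z i in the (i+1)st but not
    in the i-th; some z i lies in the span of its predecessors, all of which belong to the i-th. *)
Lemma max_colon_above b : ~ B b ->
  exists2 b', max_colon b' & forall z, B (z * b) -> B (z * b').
Proof.
move=> nBb; apply: NNPP => nomax.
pose P b' := ~ B b' /\ forall z, B (z * b) -> B (z * b').
have next (x : {b' | P b'}) : {yz : {b' | P b'} * R |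
    [/\ forall z, B (z * sval x) -> B (z * sval yz.1), B (yz.2 * sval yz.1)
      & ~ B (yz.2 * sval x)]}.
  apply: constructive_indefinite_description; case: x => x [nBx bx] /=.
  apply: NNPP => nonext; apply: nomax; exists x => //; split=> // b' nBb' xb' z zb'.
  apply: NNPP => nzx; apply: nonext.
  have Pb' : P b' by split=> // w /bx/xb'.
  by exists (exist _ b' Pb', z).
have Pb : P b by [].
pose st := fix st i := if i is j.+1 then (sval (next (st j))).1 else exist P b Pb.
pose z i := (sval (next (st i))).2.
have mono i j : (i <= j)%N -> forall w, B (w * sval (st i)) -> B (w * sval (st j)).
  elim: j => [|j IH]; first by rewrite leqn0 => /eqP->.
  rewrite leq_eqVlt => /orP[/eqP->//|/IH ij] w /ij Bw /=.
  by case: (next (st j)) => yz /= [H _ _]; apply: H.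
have [i zi] := noeth z.
have : B (z i * sval (st i)).
  apply: (zi _ (colon_ideal Bid _)) => x /mapP[j]; rewrite mem_iota /= add0n => ji ->.
  apply: (mono j.+1 i) => //=; rewrite /z.
  by case: (next (st j)) => yz /= [].
by rewrite /z; case: (next (st i)) => yz /= [].
Qed.

(** The colon ideal of v b contains that of b and is proper, so by maximality the two agree. *)
Lemma max_colon_prime b u v : max_colon b -> B (u * v * b) -> ~ B (v * b) -> B (u * b).
Proof.
move=> [nBb maxb] Buv nBv; apply: (maxb (v * b)) => //; last by rewrite mulrA.
by move=> z Bz; rewrite mulrCA; apply: idealM.
Qed.

Lemma max_colon_prod b (s : seq R) : max_colon b ->
  (forall x, x \in s -> exists2 w, B (w * x) & ~ B (w * b)) ->
  exists2 w, (forall x, x \in s -> B (w * x)) & ~ B (w * b).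
Proof.
move=> maxb; elim: s => [|x s IH] sP; first by exists 1; rewrite // mul1r; case: maxb.
have [|w ws nw] := IH; first by move=> y ys; apply: sP; rewrite inE ys orbT.
have [|w' w'x nw'] := sP x; first by rewrite inE eqxx.
exists (w * w'); last by move/(max_colon_prime maxb) => /(_ nw').
move=> y; rewrite inE => /orP[/eqP->|/ws wy].
  by rewrite -mulrA; apply: idealM.
by rewrite mulrAC mulrC; apply: idealM.
Qed.

(** Let s generate, modulo nothing else, all maximal b. If z lay in no (B : x) with x in s, then for
    a maximal b' with z in (B : b') some w would kill every x in s modulo B but not b', although b'
    is in the span of s. *)
Lemma max_colon_finite : exists2 s : seq R, (forall b, b \in s -> max_colon b) &
  forall z b, ~ B b -> B (z * b) -> exists2 b', b' \in s & B (z * b').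
Proof.
have [s [smax sgen]] := finite_basis max_colon noeth.
exists s => // z b nBb /= Bzb; have [b' maxb' bb'] := max_colon_above nBb.
apply: NNPP => none.
have [|w ws nw] := @max_colon_prod b' s maxb'.
  move=> x xs; apply: NNPP => H; apply: none; exists x => //.
  have [nBx maxx] := smax x xs; apply: (maxx b'); [by case: maxb' | | exact: bb'].
  by move=> y Byx; apply: NNPP => nByb'; apply: H; exists y.
apply: nw; rewrite mulrC; apply: (sgen b' maxb' _ (colon_ideal Bid w)) => x xs.
by rewrite mulrC; apply: ws.
Qed.

Variable I : R -> Prop.
Hypothesis Iid : is_ideal I.

(** Prime avoidance. If z falls into (B : b), it is replaced by z + x w, where w lies in the colon
    ideals of all of s but not in (B : b), and x is an element of I outside (B : b). *)
Lemma max_colon_avoid (s : seq R) : (forall b, b \in s -> max_colon b) ->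
  (forall b, b \in s -> exists2 x, I x & ~ B (x * b)) ->
  exists2 z, I z & forall b, b \in s -> ~ B (z * b).
Proof.
elim: s => [|b s IH] smax sI; first by exists 0 => //; apply: ideal0 Iid.
have [||z Iz zs] := IH.
- by move=> x xs; apply: smax; rewrite inE xs orbT.
- by move=> x xs; apply: sI; rewrite inE xs orbT.
have maxb : max_colon b by apply: smax; rewrite inE eqxx.
have [Bzb|nBzb] := classic (B (z * b)); last first.
  by exists z => // x; rewrite inE => /orP[/eqP->|/zs].
have [|w ws nw] := @max_colon_prod b s maxb.
  move=> x xs; apply: NNPP => H; apply: (zs x xs).
  have [nBx maxx] : max_colon x by apply: smax; rewrite inE xs orbT.
  apply: (maxx b) => //; first by case: maxb.
  by move=> y Byx; apply: NNPP => nByb; apply: H; exists y.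
have [|x Ix nx] := sI b; first by rewrite inE eqxx.
exists (z + x * w).
  by apply: (idealD Iid) => //; rewrite mulrC; apply: (idealM Iid).
move=> y; rewrite inE mulrDl => /orP[/eqP->|ys] By.
  have /(max_colon_prime maxb)/(_ nw)// : B (x * w * b).
  by rewrite -[_ * b](addKr (z * b)) addrC; apply: (idealB Bid).
apply: (zs y ys); rewrite -[z * y](addrK (x * w * y)); apply: (idealB Bid) => //.
by rewrite -mulrA; apply: (idealM Bid); apply: ws.
Qed.

Lemma exists_regular_element :
  (forall b, ~ B b -> exists2 x, I x & ~ B (x * b)) ->
  exists2 z, I z & forall b, B (z * b) -> B b.
Proof.
move=> nosocle; have [s smax sP] := max_colon_finite.
have [|z Iz zs] := @max_colon_avoid s smax.
  by move=> b /smax[nBb _]; apply: nosocle.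
exists z => // b Bzb; apply: NNPP => nBb.
by have [b' /zs] := sP z b nBb Bzb.
Qed.

End ZeroDivisors.

(** * Regular sequences *)

Section RegularSequence.
Variable R : comNzRingType.
Implicit Types (B : R -> Prop) (ys : seq R).

Definition adjoin B y : R -> Prop := fun u => exists v, B (u - y * v).

Definition adjoins B ys := foldl adjoin B ys.

Lemma adjoin_ideal B y : is_ideal B -> is_ideal (adjoin B y).
Proof.
move=> Bid; split=> [|a u v [u' Bu] [v' Bv]].
  by exists 0; rewrite mulr0 subr0; apply: ideal0 Bid.
exists (a * u' + v'); rewrite (_ : _ - _ = a * (u - y * u') + (v - y * v')).
  exact: Bid.2.
by rewrite mulrBr mulrDr opprD addrACA [a * (y * _)]mulrCA.
Qed.

Lemma adjoins_ideal B ys : is_ideal B -> is_ideal (adjoins B ys).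
Proof. by elim: ys B => //= y ys IH B /(adjoin_ideal y)/IH. Qed.

Lemma adjoin_sub B y J u : is_ideal J -> (forall x, B x -> J x) -> J y ->
  adjoin B y u -> J u.
Proof.
move=> Jid BJ Jy [v /BJ Ju]; rewrite -(subrK (y * v) u); apply: (idealD Jid) => //.
by rewrite mulrC; apply: (idealM Jid).
Qed.

Lemma adjoins_sub B ys J u : is_ideal J -> (forall x, B x -> J x) ->
  (forall y, y \in ys -> J y) -> adjoins B ys u -> J u.
Proof.
move=> Jid; elim: ys B => [|y ys IH] B BJ ysJ /=; first exact: BJ.
apply: IH => [x|x xs]; last by apply: ysJ; rewrite inE xs orbT.
by apply: adjoin_sub => //; apply: ysJ; rewrite inE eqxx.
Qed.

Lemma adjoins_rcons B ys y : adjoins B (rcons ys y) = adjoin (adjoins B ys) y.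
Proof. by rewrite /adjoins foldl_rcons. Qed.

Lemma sub_adjoins B ys u : is_ideal B -> B u -> adjoins B ys u.
Proof.
elim: ys B => //= y ys IH B Bid Bu; apply: IH; first exact: adjoin_ideal.
by exists 0; rewrite mulr0 subr0.
Qed.

(** Coefficients indexed by [nat] do not change type when the sequence grows. *)
Lemma in_smul_nat (M : lmodType R) ys (x : M) :
  in_smul ys x <-> exists c : nat -> M, x = \sum_(0 <= i < size ys) ys`_i *: c i.
Proof.
split=> [[c ->]|[c ->]]; last by exists c; rewrite big_mkord.
exists (fun i => if insub i is Some j then c j else 0).
by rewrite big_mkord; apply: eq_bigr => i _; rewrite valK.
Qed.

Lemma in_smul_rcons (M : lmodType R) ys y (x : M) :
  in_smul (rcons ys y) x <-> exists v, in_smul ys (x - y *: v).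
Proof.
have E (c : nat -> M) : \sum_(0 <= i < size (rcons ys y)) (rcons ys y)`_i *: c i =
    \sum_(0 <= i < size ys) ys`_i *: c i + y *: c (size ys).
  rewrite size_rcons big_nat_recr //= nth_rcons ltnn eqxx; congr (_ + _).
  by apply: eq_big_nat => i /= lt; rewrite nth_rcons lt.
split=> [/in_smul_nat[c ->]|[v /in_smul_nat[c xE]]].
  by exists (c (size ys)); apply/in_smul_nat; exists c; rewrite E addrK.
apply/in_smul_nat; exists (fun i => if i == size ys then v else c i).
rewrite E eqxx -[LHS](subrK (y *: v)) xE; congr (_ + _).
by apply: eq_big_nat => i /= lt; rewrite ltn_eqF.
Qed.

Lemma in_smul_quot (a : ideal R) ys (u : R) :
  in_smul ys (quot_pi a u) <-> adjoins (fun f => f \in a) ys u.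
Proof.
have piZ (y v : R) : y *: quot_pi a v = quot_pi a (y * v) by apply: quot_scale_pi.
have piB (x y : R) : quot_pi a x - quot_pi a y = quot_pi a (x - y).
  by apply/eqP; rewrite subr_eq -quot_piD subrK.
elim/last_ind: ys u => [|ys y IH] u.
  have pi0 : quot_pi a u = 0 <-> u \in a.
    by rewrite -(subrr (quot_pi a u)) piB subrr quot_pi_eq subr0.
  split=> [[c]|/= ua]; first by rewrite big_ord0 => /pi0.
  by exists (fun=> 0); rewrite big_ord0; apply/pi0.
rewrite adjoins_rcons; split.
  move=> /in_smul_rcons[v]; rewrite -[v]quot_piK piZ piB => /IH H.
  by exists (repr v).
move=> [v /IH H]; apply/in_smul_rcons; exists (quot_pi a v).
by rewrite piZ piB.
Qed.

End RegularSequence.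

Section KoszulRegular.
Variables (k : fieldType) (n : nat).
Local Notation R := {mpoly k[n]}.
Local Notation kos := (bdy (@var_mon n)).
Implicit Types B : R -> Prop.

Lemma kos_in B (f : {set 'I_n} -> R^o) S : is_ideal B ->
  (forall S, B (f S)) -> B (kos f S).
Proof. by move=> Bid Bf; apply: (ideal_sum Bid) => i _; apply: (idealM Bid). Qed.

(** A chase of the long exact sequence of multiplication by y on R/B. *)
Lemma koszul_adjoin B y e : is_ideal B -> (forall x, B (y * x) -> B x) ->
  koszul_quot_vanish B e -> koszul_quot_vanish (adjoin B y) e.+1.
Proof.
move=> Bid yreg HB [//|i] F ei pF BF.
have kosZ (f : {set 'I_n} -> R^o) S : kos (fun S => y * f S : R^o) S = y * kos f S.
  exact: bdyZ.
have /fin_all_exists[v vP] S : exists v : R^o, B (kos F S - y * v) by apply: BF.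
pose g := trunc i.+1 v.
have gP S : B (kos F S - y * g S).
  rewrite /g /trunc; case: ifP => // /negbT Si.
  by rewrite (bdy_pure (@var_mon n) pF Si) mulr0 subr0; apply: ideal0 Bid.
have [|||h ph hP] := HB i g.
- by [].
- exact: trunc_pure.
(* Modulo B, y times kos g is kos (kos F) = 0, and y can be cancelled. *)
- move=> S; apply: yreg; rewrite -kosZ -[X in B X]opprK; apply: (idealN Bid).
  rewrite -[X in B X]add0r -[X in X - _](bdy_bdy (@var_mon n) F S) -bdyB.
  exact: kos_in.
have [|||G pG GP] := HB i.+1 (fun S => F S - y * h S : R^o).
- exact: ltnW.
- by move=> S Si; rewrite pF ?ph // mulr0 subr0.
- move=> S; rewrite bdyB kosZ.
  rewrite (_ : _ - _ = (kos F S - y * g S) + y * (g S - kos h S)).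
    by apply: (idealD Bid) => //; apply: (idealM Bid).
  by rewrite mulrBr addrA subrK.
exists G => // S; exists (h S); rewrite addrAC; exact: GP.
Qed.

(** The chain with value u on the full set is a Koszul cycle of degree n modulo B. There are no
    chains of degree n+1, so the vanishing of its class puts u in B. *)
Lemma koszul_socle B e u : is_ideal B -> (e < n)%N -> koszul_quot_vanish B e ->
  (forall i, B ('X_i * u)) -> B u.
Proof.
move=> Bid en HB Bu.
have [i ni] : exists i, n = i.+1 by case: (n) en => // i _; exists i.
pose F (S : {set 'I_n}) : R^o := if S == setT then u else 0.
have [|||G _ /(_ setT)] := HB i F.
- by rewrite -ltnS -ni.
- move=> S; rewrite /F; case: (eqVneq S setT) => // ->.
  by case/eqP; rewrite cardsT card_ord.
- move=> S; apply: (ideal_sum Bid) => l lS; rewrite /F; case: eqP => _; last first.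
    by rewrite scaler0; apply: ideal0 Bid.
  rewrite /GRing.scale /= -mulrA; apply: (idealM Bid).
  suff -> : lcm_ratio k (@var_mon n) S (l |: S) = 'X_l by [].
  rewrite /lcm_ratio; congr 'X_[_]; apply/mnmP => j; rewrite mnmBE lcmSU1 /var_mon mnm1E.
  case: (eqVneq l j) => [<-|_]; last by rewrite max0n subnn.
  suff -> : lcmS (@var_mon n) S l = 0%N by [].
  apply/eqP; rewrite -leqn0 lcmSE; apply/bigmax_leqP => l' l'S; rewrite /var_mon mnm1E.
  by case: eqP l'S lS => [->->|].
rewrite /F eqxx /bdy big1 ?subr0 // => l; by rewrite inE.
Qed.

End KoszulRegular.

(** * From Koszul homology to depth *)

Section Depth.
Variables (k : fieldType) (n : nat) (a : ideal {mpoly k[n]}).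
Local Notation R := {mpoly k[n]}.
Local Notation a_pred := (fun f : R => f \in a).

Lemma submod_is_ideal : is_ideal a_pred.
Proof. by have [a0 aP] := submodClosedP a; split=> // b x y; apply: aP. Qed.

(** A proper ideal containing the variables; it will show that a longer sequence still has a nonzero
    quotient. *)
Lemma constant_coeff_ideal : is_ideal (fun f : R => f@_0 = 0).
Proof.
split=> [|b x y x0 y0]; first exact: mcoeff0.
by rewrite mcoeffD y0 addr0 (mcoeff0_is_multiplicative n k).1 x0 mulr0.
Qed.

Lemma koszul_quot_vanish_cd c : squarefree_monomial_ideal a ->
  (forall j, (c < j)%N -> local_cohomology_eq0 a (R^o : lmodType R) j) ->
  koszul_quot_vanish a_pred c.
Proof.
move=> [s s_sqfree aP] Hc.
pose mon (i : 'I_(size s)) := tnth (in_tuple s) i.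
have mon_sqfree i : squarefree (mon i) by apply: (allP s_sqfree); apply: mem_tnth.
have aE f : f \in a <-> exists b : 'I_(size s) -> R, f = \sum_i b i * 'X_[mon i].
  have e : size s = size [seq 'X_[k, m] | m <- s] by rewrite size_map.
  have sumE (b : 'I_(size [seq 'X_[k, m] | m <- s]) -> R) :
      \sum_i b i * [seq 'X_[k, m] | m <- s]`_i
      = \sum_i b (cast_ord e i) * 'X_[mon i].
    rewrite (reindex (cast_ord e)); last exact/onW_bij/(Bijective (cast_ordK e) (cast_ordKV e)).
    apply: eq_bigr => i _; rewrite /mon (tnth_nth 0%MM) /=.
    by rewrite (nth_map 0%MM).
  split=> [/aP[b ->]|[b ->]]; first by exists (fun i => b (cast_ord e i)); rewrite sumE.
  apply/aP; exists (fun i => b (cast_ord (esym e) i)); rewrite sumE.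
  by apply: eq_bigr => i _; rewrite cast_ordK.
have mon_a i : 'X_[mon i] \in a.
  apply/aP/mem_generated_by/map_f; exact: mem_tnth.
have a_mon f : f \in a -> exists b : 'I_(size s) -> R, f = \sum_i b i * 'X_[mon i].
  by move/aE.
(* The injective resolution may vary with the degree, since [taylor_dual_exact] uses a single degree
   at a time. *)
have [eps [eps_d eps_id]] := @taylor_splitting k n _ mon c
  (fun p f cp pf f0 => let: ex_intro E HE := Hc p.+1 cp in
     taylor_dual_exact mon_a a_mon mon_sqfree HE pf f0).
apply: (koszul_quot_coker (mon := mon)); first exact: aE.
have top : koszul_coker_vanish k mon c 0 by apply: koszul_coker_top eps_d eps_id.
(* Each dimension shift lowers the cokernel index by one and raises the bound by one. *)
suff down c' e : koszul_coker_vanish k mon c' e -> koszul_coker_vanish k mon 0 (c' + e).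
  by rewrite -[c]addn0; apply: down.
elim: c' e => // c' IH e /koszul_coker_step/IH.
by rewrite addnS.
Qed.

Lemma irrelevant_ideal_is_ideal : is_ideal (irrelevant_ideal k n).
Proof. exact: generated_by_ideal. Qed.

Lemma var_irrelevant i : irrelevant_ideal k n 'X_i.
Proof. by apply: mem_generated_by; apply: map_f; rewrite mem_enum. Qed.

Lemma irrelevant_constant_coeff f : irrelevant_ideal k n f -> f@_0 = 0.
Proof.
apply: generated_by_sub constant_coeff_ideal _ => x /mapP[i _ ->].
by rewrite mcoeffX mnm1_eq0.
Qed.

Lemma monomial_ideal_constant_coeff s f :
  (forall f, f \in a <-> generated_by [seq 'X_[k, m] | m <- s] f) ->
  1 \notin a -> f \in a -> f@_0 = 0.
Proof.
move=> aP a1 /aP; apply: generated_by_sub constant_coeff_ideal _ => x /mapP[m ms ->].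
rewrite mcoeffX; case: eqP => // m0; case/negP: a1; apply/aP/mem_generated_by.
by apply/mapP; exists m => //; rewrite m0 mpolyX0.
Qed.

Lemma koszul_quot_vanish_regular c ys : regular_seq (quot_mod a) ys ->
  koszul_quot_vanish a_pred c -> koszul_quot_vanish (adjoins a_pred ys) (c + size ys).
Proof.
move=> [reg _] Hc.
suff: forall i, (i <= size ys)%N ->
    koszul_quot_vanish (adjoins a_pred (take i ys)) (c + i).
  by move/(_ _ (leqnn _)); rewrite take_size.
elim=> [|i IH] lt_i; first by rewrite take0 addn0.
rewrite (take_nth 0) // adjoins_rcons addnS; apply: koszul_adjoin.
- exact/adjoins_ideal/submod_is_ideal.
- move=> x /in_smul_quot H; apply/in_smul_quot; apply: reg lt_i _ _.
  by have -> : ys`_i *: quot_pi a x = quot_pi a (ys`_i * x) by apply: quot_scale_pi.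
- exact/IH/ltnW.
Qed.

Lemma maximal_regular_seq_size c ys : squarefree_monomial_ideal a ->
  koszul_quot_vanish a_pred c ->
  maximal_regular_seq (irrelevant_ideal k n) (quot_mod a) ys -> (n <= c + size ys)%N.
Proof.
move=> [s _ aP] Hc [ysm reg maxys]; rewrite leqNgt; apply/negP => lt_n.
pose B := adjoins a_pred ys.
have Bid : is_ideal B by apply/adjoins_ideal/submod_is_ideal.
have a1 : 1 \notin a.
  case: reg => _ [x nx]; apply/negP => a1; apply: nx.
  rewrite -[x]quot_piK; apply/in_smul_quot; apply: sub_adjoins; first exact: submod_is_ideal.
  by rewrite -[repr x]mulr1; apply: (idealM submod_is_ideal).
(* The absence of a socle is exactly the hypothesis of prime avoidance: for b outside B, some
   variable does not send b into B. *)
have [b nBb|z mz zreg] := exists_regular_element (@mpoly_noetherian k n) Bid irrelevant_ideal_is_ideal.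
  apply: NNPP => socle; apply: nBb.
  apply: (koszul_socle Bid lt_n (koszul_quot_vanish_regular reg Hc)) => i.
  by apply: NNPP => nBi; apply: socle; exists 'X_i => //; apply: var_irrelevant.
apply: (maxys z mz); split.
  move=> i; rewrite size_rcons ltnS leq_eqVlt => /orP[/eqP->|lt_i] x.
    rewrite -cats1 take_size_cat // nth_cat ltnn subnn /= -[x]quot_piK.
    have -> : z *: quot_pi a (repr x) = quot_pi a (z * repr x) by apply: quot_scale_pi.
    by move=> /in_smul_quot/zreg Bx; apply/in_smul_quot.
  rewrite -cats1 takel_cat ?(ltnW lt_i) // nth_cat lt_i.
  by case: reg => + _; apply.
(* The class of 1 survives: the ideal a, the sequence and z all consist of polynomials without
   constant term. *)
exists (quot_pi a 1) => /in_smul_quot.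
move/(adjoins_sub constant_coeff_ideal) => H; have : (1 : R)@_0 = 0.
  apply: H => [x|x]; first exact: monomial_ideal_constant_coeff aP a1.
  rewrite mem_rcons inE => /orP[/eqP->|/ysm]; exact: irrelevant_constant_coeff.
by rewrite mcoeff1 eqxx => /eqP; rewrite oner_eq0.
Qed.

End Depth.

Theorem lemma2p3 (k : fieldType) (n : nat) (a : ideal {mpoly k[n]}) (t : nat)
    (ha : squarefree_monomial_ideal a)
    (c : nat) (hc : is_cd a c) (hct : c%:Z <= n%:Z - t%:Z) :
  forall d : option nat, is_depth (irrelevant_ideal k n) (quot_mod a) d ->
    ext_nat_ge d t.
Proof.
case=> [r|] //= [ys ys_max <-].
have le p : (n <= c + p)%N -> (t <= p)%N by move: hct; lia.
exact/le/(maximal_regular_seq_size ha (koszul_quot_vanish_cd ha hc.1) ys_max).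
Qed.
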